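(* Let $E\subseteq F\subseteq F'$ be countable Borel equivalence relations on a standard Borel space $X$ such that every $F'$-class contains only finitely many $E$-classes and $E$ is normal in $F'$. Then every $(E,F)$-link is contained in some $(E,F')$-link.
   Context: A countable Borel equivalence relation (CBER) is a Borel equivalence relation with countable classes. $\mathrm{Aut}_B(E)$ is the group of Borel bijections $T:X\to X$ with $x\mathrel E y\iff T(x)\mathrel E T(y)$. $E$ is normal in $F'$ if there is a countable subgroup $G\le\mathrm{Aut}_B(E)$ with $F' = E^{\vee G}$, where $x\mathrel{E^{\vee G}}y\iff\exists g\in G\,(g(x)\mathrel E y)$. For CBERs $E\subseteq F$, an $(E,F)$-link is a CBER $L\subseteq F$ such that for every $F$-class $C$, every $(E\upharpoonright C)$-class meets every $(L\upharpoonright C)$-class in exactly one point. *)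

(* Defs.v *)
From mathcomp Require Import all_boot all_order all_algebra.
From mathcomp Require Import all_classical all_reals all_analysis.

Set Implicit Arguments.
Unset Strict Implicit.
Unset Printing Implicit Defensive.

Local Open Scope classical_set_scope.

(* A complete pseudometric that is Hausdorff is a complete metric.  All models
   [R] of the reals are isomorphic, so the choice of [R] is immaterial. *)
Definition polish (R : realType) (P : completePseudoMetricType R) : Prop :=
  hausdorff_space P /\ exists D : set P, countable D /\ dense D.

Definition borel_type (T : ptopologicalType) := g_sigma_algebraType (@open T).

Definition standard_borel (R : realType) (d : measure_display)
    (X : measurableType d) : Prop :=
  exists P : completePseudoMetricType R, polish P /\
    exists (f : X -> borel_type P) (g : borel_type P -> X),
      [/\ cancel f g, cancel g f,
          measurable_fun [set: X] f & measurable_fun [set: borel_type P] g].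

(* Relations on [X] are sets of pairs, so that "Borel" is measurability for the
   product sigma-algebra. *)
Section relations.
Context {X : Type}.
Implicit Types (E : set (X * X)) (C : set X).

Definition eclass E (x : X) : set X := [set y | E (x, y)].

Definition classes C E : set (set X) := [set eclass E x | x in C].

Definition restr E C : set (X * X) := E `&` (C `*` C).

End relations.

Section cber.
Context {d : measure_display} {X : measurableType d}.
Implicit Types (E F L : set (X * X)) (G : set (X -> X)).

Record cber E : Prop := {
  cber_measurable : measurable E;
  cber_refl : forall x, E (x, x);
  cber_sym : forall x y, E (x, y) -> E (y, x);
  cber_trans : forall x y z, E (x, y) -> E (y, z) -> E (x, z);
  cber_countable : forall x, countable (eclass E x) }.

Definition AutB E : set (X -> X) :=
  [set T | [/\ bijective T, measurable_fun [set: X] T &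
               forall x y, E (x, y) <-> E (T x, T y)]].

Record AutB_subgroup E G : Prop := {
  subgroup_sub : G `<=` AutB E;
  subgroup_id : G idfun;
  subgroup_comp : forall g h, G g -> G h -> G (g \o h);
  subgroup_inv : forall g, G g ->
    exists2 h, G h & cancel g h /\ cancel h g }.

Definition group_join E G : set (X * X) :=
  [set p | exists2 g, G g & E (g p.1, p.2)].

Definition normal_in E F : Prop :=
  exists G, [/\ countable G, AutB_subgroup E G & F = group_join E G].

Definition finite_index E F : Prop :=
  forall C, classes [set: X] F C ->
    finite_set [set A | classes [set: X] E A /\ A `<=` C].

Definition link E F L : Prop :=
  [/\ cber L, L `<=` F &
      forall C, classes [set: X] F C ->
        forall A B, classes C (restr E C) A -> classes C (restr L C) B ->
          exists! x, (A `&` B) x].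

End cber.

(* Main.v *)
Require Import Defs.
From mathcomp Require Import all_boot all_order all_algebra.
From mathcomp Require Import all_classical all_reals all_analysis.

(* Let [W] enumerate the words in the group elements [g_n] and in the functions
   sending [x] to the point of its [L]-class that is [E]-equivalent to [g_n x].
   Their orbit relation [R], contained in [F'], meets every [E]-class of an
   [F']-class and contains [L], so it is enough to extend [L] to a transversal
   relation inside [R], and there all quantifiers range over [nat].  The
   functions defined from [L] are Borel because a function with a Borel graph is
   Borel, by Lusin's separation theorem.

   A greedy choice of pairwise disjoint [L]-invariant transversals of the
   [E]-classes leaves, in each orbit, a set that misses some [E]-class.  Where it
   is empty the chosen transversals form the extension.  Elsewhere, going from an
   [E]-class that is exhausted to one that is not, along the chosen transversals,
   and back by the group gives an injection of each [E]-class into itself that is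
   not onto.  Infinitely many points of one of its chains have the same rank in
   their (finite) [L]-class; they encode the whole orbit injectively into the
   [L]-classes of any [F]-class.  By Schroeder-Bernstein the [L]-classes of every
   [F]-class are thus indexed by the points of the orbit, in a way that depends
   only on the [F]-class, and [L]-classes with the same index are united. *)

Set Implicit Arguments.
Unset Strict Implicit.
Unset Printing Implicit Defensive.

Local Open Scope classical_set_scope.

(** * Sets decided by the late terms of convergent sequences *)

Section decidable_sets.
Variables (Z : Type) (conv : (nat -> Z) -> Z -> Prop).
Implicit Types (A : set Z) (P : nat -> nat -> set Z) (u : nat -> Z).

Definition countable_covers P := forall n z, exists k, P n k z.

Definition follows P u :=
  forall n, exists k, \forall m \near \oo, P n k (u m).

(* [A] is clopen for the sequences that eventually settle in one member of each
   of countably many countable covers. *)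
Definition settled A := exists P, countable_covers P /\
  forall u a, conv u a -> follows P u ->
    (A a /\ \forall m \near \oo, A (u m)) \/
    (~ A a /\ \forall m \near \oo, ~ A (u m)).

Lemma near_and_not (Q : set nat) :
  (\forall m \near \oo, Q m) -> (\forall m \near \oo, ~ Q m) -> False.
Proof.
by move=> q nq; near \oo => m; apply: (near nq m) => //; near: m.
Unshelve. all: by end_near. Qed.

Lemma settledC A : settled A -> settled (~` A).
Proof.
move=> [P [cP AP]]; exists P; split=> // u a ua Pu.
have [[Aa Au]|[nAa nAu]] := AP u a ua Pu; [right|by left].
by split; [exact|apply: filterS Au => m Am].
Qed.

(** To the covers for the single [A i] one more is added: the sets [A i] themselves and the
    complement of their union. The member of it in which a sequence settles tells on which side the
    limit lies. *)
Lemma settled_bigcup (A : (set Z)^nat) :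
  (forall i, settled (A i)) -> settled (\bigcup_i A i).
Proof.
move=> /choice[P AP].
pose S k := if k is i.+1 then A i else ~` \bigcup_i A i.
pose P' n k := if unpickle n is Some (Some (i, j)) then P i j k else S k.
exists P'; split=> [n z|u a ua Pu].
  rewrite /P'; case: (unpickle n) => [[[i j]|]|]; first exact: (AP i).1;
    (have [[i _ Aiz]|nA] := pselect ((\bigcup_i A i) z);
       [by exists i.+1|by exists 0%N]).
have AU i : (A i a /\ \forall m \near \oo, A i (u m)) \/
    (~ A i a /\ \forall m \near \oo, ~ A i (u m)).
  apply: (AP i).2 => // j; have [k] := Pu (pickle (Some (i, j))).
  by rewrite /P' pickleK; exists k.
have [[|i]] := Pu (pickle (None : option (nat * nat)));
  rewrite /P' pickleK /= => Su.
- right; split=> // -[i _ Aia]; have [[_ Aiu]|[//]] := AU i.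
  by apply: near_and_not Aiu _; apply: filterS Su => m nA Aim; apply: nA; exists i.
- left; have [[Aia _]|[_ nA]] := AU i; last by have := near_and_not Su nA.
  by split; [exists i|apply: filterS Su => m Aim; exists i].
Qed.

Lemma settled_sigma_algebra : sigma_algebra setT settled.
Proof.
split.
- exists (fun _ _ => setT); split=> [n z|u a _ _]; first by exists 0%N.
  by right; split=> [[]|]; apply: nearW => ? [].
- by move=> A; rewrite setTD; exact: settledC.
- exact: settled_bigcup.
Qed.

End decidable_sets.

(** * Separation of projections by Borel sets *)

Section separation.
Variables (d : measure_display) (X : measurableType d) (Z : Type) (p : Z -> X).
Implicit Types A B : set Z.

Definition separated A B :=
  exists C, [/\ measurable C, p @` A `<=` C & p @` B `<=` ~` C].

Lemma separatedC A B : separated A B -> separated B A.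
Proof.
move=> [C [mC AC BC]]; exists (~` C); split=> //; first exact: measurableC.
by rewrite setCK.
Qed.

(** The union of the sets separating the pieces of [A] from [B] separates. *)
Lemma separated_cover A B (P : nat -> set Z) :
  (forall z, exists k, P k z) -> (forall k, separated (A `&` P k) B) ->
  separated A B.
Proof.
move=> cP /choice[C sC]; exists (\bigcup_k C k); split.
- by apply: bigcupT_measurable => k; case: (sC k).
- move=> _ [z Az <-]; have [k Pkz] := cP z.
  by exists k => //; case: (sC k) => _ + _; apply; exists z.
- move=> x Bx [k _ Ckx]; have [_ _ BC] := sC k; exact: (BC _ Bx Ckx).
Qed.

Lemma not_separated_cover A B (P : nat -> set Z) :
  (forall z, exists k, P k z) -> ~ separated A B ->
  exists k l, ~ separated (A `&` P k) (B `&` P l).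
Proof.
move=> cP nAB; apply: contrapT => nkl; apply: nAB.
apply: (separated_cover cP) => k; apply: separatedC.
apply: (separated_cover cP) => l; apply: separatedC.
by apply: contrapT => s; apply: nkl; exists k, l.
Qed.

Lemma not_separated_nonempty A B : ~ separated A B -> A !=set0.
Proof.
move=> nAB; apply: contrapT => A0; apply: nAB; exists set0; split=> //.
- by move=> x [z Az _]; case: A0; exists z.
- by rewrite setC0.
Qed.

(* The argument of Lusin's theorem: as separability of all pieces would give
   separability, an inseparable pair can be shrunk within the covers for ever. *)
Lemma not_separated_follows A B (P : nat -> nat -> set Z) :
  countable_covers P -> ~ separated A B ->
  exists (u v : nat -> Z) (k l : nat -> nat),
    (forall m, A (u m) /\ B (v m)) /\
    forall n, [/\ ~ separated (P n (k n)) (P n (l n)),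
      \forall m \near \oo, P n (k n) (u m) &
      \forall m \near \oo, P n (l n) (v m)].
Proof.
move=> cP nAB.
have step n (S : set Z * set Z) : exists kl : nat * nat,
    ~ separated S.1 S.2 -> ~ separated (S.1 `&` P n kl.1) (S.2 `&` P n kl.2).
  have [sS|nS] := pselect (separated S.1 S.2); first by exists (0, 0)%N.
  by have [k [l kl]] := not_separated_cover (cP n) nS; exists (k, l).
pose kl n S := projT1 (cid (step n S)).
pose S := fix S n := if n is m.+1 then
  let q := kl m (S m) in ((S m).1 `&` P m q.1, (S m).2 `&` P m q.2) else (A, B).
have nS n : ~ separated (S n).1 (S n).2.
  by elim: n => //= n IHn; exact: (projT2 (cid (step n (S n))) IHn).
have SD n m : (n <= m)%N -> (S m).1 `<=` (S n).1 /\ (S m).2 `<=` (S n).2.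
  move=> /subnKC <-; elim: (m - n)%N => [|i [IH1 IH2]]; first by rewrite addn0; split.
  by rewrite addnS /=; split=> z [? _]; [exact: IH1|exact: IH2].
have [u uS] := choice (fun n => not_separated_nonempty (nS n)).
have nS' n : ~ separated (S n).2 (S n).1 by move=> /separatedC; exact: nS.
have [v vS] := choice (fun n => not_separated_nonempty (nS' n)).
exists u, v, (fun n => (kl n (S n)).1), (fun n => (kl n (S n)).2); split=> [m|n].
  by have [SA SB] := SD 0%N m (leq0n m); split; [exact: SA|exact: SB].
split.
- move=> [C [mC AC BC]]; apply: (nS n.+1); exists C; split=> //=.
    by move=> _ [z [_ Pz] <-]; apply: AC; exists z.
  by move=> _ [z [_ Pz] <-]; apply: BC; exists z.
- by exists n.+1 => // m /= nm; have [] := (SD n.+1 m nm).1 _ (uS m).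
- by exists n.+1 => // m /= nm; have [] := (SD n.+1 m nm).2 _ (vS m).
Qed.

End separation.

(** * Lusin separation and Borel graphs *)

Section standard_borel.
Variables (R : realType) (d : measure_display) (X : measurableType d).
Variables (P : completePseudoMetricType R) (f : X -> borel_type P)
  (g : borel_type P -> X).
Hypotheses (hP : hausdorff_space P) (fK : cancel f g) (gK : cancel g f)
  (mf : measurable_fun setT f) (mg : measurable_fun setT g).
Variable q : nat -> P.
Hypothesis dq : dense (range q).

Import Order.TTheory GRing.Theory Num.Theory.
Local Open Scope ring_scope.

Local Notation e n := (n.+1%:R^-1 : R).

Let e_gt0 n : 0 < e n. Proof. by rewrite invr_gt0. Qed.

Lemma dense_ball_cover n x : exists k, ball (q k) (e n) x.
Proof.
have [y [[k _ <-] yx]] : range q `&` (ball x (e n))° !=set0.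
  rewrite setIC; apply: dq; last exact: open_interior.
  by exists x; apply: nbhsx_ballx.
by exists k; apply: ball_sym; exact: interior_subset yx.
Qed.

Lemma measurable_pre_ball x (r : R) : measurable (f @^-1` ((ball x r)° : set P)).
Proof.
rewrite -[_ @^-1` _]setTI; apply: mf => //; apply: sub_sigma_algebra.
exact: open_interior.
Qed.

Definition conv2 (u : nat -> X * X) (a : X * X) :=
  (fun m => f (u m).1 : P) @ \oo --> (f a.1 : P) /\
  (fun m => f (u m).2 : P) @ \oo --> (f a.2 : P).

(** The cover consists of the complement of [O] and of the sets of points around which [O] contains
    a ball of radius [e i]. A limit of points of one of the latter lies in such a ball around a late
    term, hence in [O]. *)
Lemma settled_open (p : X * X -> X) (O : set P) :
  (forall u a, conv2 u a -> (fun m => f (p (u m)) : P) @ \oo --> (f (p a) : P)) ->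
  open O -> settled conv2 [set z | O (f (p z))].
Proof.
move=> cp oO; pose C k z := if k is i.+1 then ball (f (p z) : P) (e i) `<=` O
  else ~ O (f (p z)).
exists (fun=> C); split=> [_ z|u a ua /(_ 0%N)[k]].
  have [Oz|nOz] := pselect (O (f (p z))); last by exists 0%N.
  have /nbhs_ballP[r /= r0 rO] : nbhs (f (p z) : P) O by exact: open_nbhs_nbhs.
  have [i _ /(_ i (leqnn _)) ir] := near_infty_natSinv_lt (PosNum r0).
  exists i.+1 => y zy; apply: rO; apply: le_ball zy; exact: ltW.
have pua := cp _ _ ua.
case: k => [|i] /= Cu.
  right; split=> // Oa; have /pua : nbhs (f (p a) : P) O by exact: open_nbhs_nbhs.
  by move=> /near_and_not; apply; exact: Cu.
left; suff Oa : O (f (p a)).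
  by split=> //; apply: pua; exact: open_nbhs_nbhs.
have /pua ua' : nbhs (f (p a) : P) (ball (f (p a) : P) (e i)).
  exact: nbhsx_ballx.
near \oo => m; have : ball (f (p (u m)) : P) (e i) `<=` O by near: m.
by apply; apply: ball_sym; near: m.
Unshelve. all: by end_near. Qed.

(** Settled sets form a sigma-algebra, so it is enough to treat preimages under the two coordinates,
    and among these the preimages of open sets of [P]. *)
Lemma settled_measurable (A : set (X * X)) : measurable A -> settled conv2 A.
Proof.
have coord (p : X * X -> X) : (forall u a, conv2 u a ->
    (fun m => f (p (u m)) : P) @ \oo --> (f (p a) : P)) ->
    forall B, measurable B -> settled conv2 (p @^-1` B).
  move=> cp B mB.
  have [S0 SC SU] := settled_sigma_algebra conv2.
  have : (measurable : set (set (borel_type P))) (g @^-1` B).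
    by rewrite -[_ @^-1` _]setTI; apply: mg.
  have -> : p @^-1` B = [set z | (g @^-1` B) (f (p z))].
    by apply/funext => z /=; rewrite fK.
  apply: (@smallest_sub _ (sigma_algebra setT) (@open P)
    [set B | settled conv2 [set z | B (f (p z))]] _ _ (g @^-1` B)).
    split=> // [{mB}B sB|{mB}B sB].
      by rewrite setTD; exact: settledC sB.
    exact: SU sB.
  by move=> O oO; exact: settled_open.
apply: smallest_sub; first exact: settled_sigma_algebra.
by move=> _ [] [B mB <-]; rewrite setTI; apply: coord => // u a [].
Qed.

Lemma ball_cover_cvg (x : nat -> P) :
  (forall n, exists k, \forall m \near \oo, ball (q k) (e n) (x m)) ->
  cvg (x @ \oo).
Proof.
move=> xq; apply/cauchy_cvgP/cauchy_exP => _/posnumP[r].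
have [n _ /(_ n (leqnn _)) nr] := near_infty_natSinv_lt r.
have [k kx] := xq n; exists (q k).
by apply: filterS kx => m; apply: le_ball; exact: ltW.
Qed.

Theorem separation (A B : set (X * X)) : measurable A -> measurable B ->
  (forall z w, A z -> B w -> z.1 <> w.1) -> separated (fst : X * X -> X) A B.
Proof.
move=> /settled_measurable[PA [cPA sA]] /settled_measurable[PB [cPB sB]] AB.
(* All covers are interleaved: those deciding [A], those deciding [B], and in each coordinate the
   covers by balls of radius [e n], which force convergence. The branch [None] is a filler for
   numbers that code nothing. *)
pose ballC (p : X * X -> X) n k := [set z | ball (q k) (e n) (f (p z))].
pose C n := match unpickle n with
  | Some (inl i) => PA i | Some (inr (inl i)) => PB i
  | Some (inr (inr (inl i))) => ballC fst i
  | Some (inr (inr (inr i))) => ballC snd i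
  | None => ballC fst 0%N end.
have cC : countable_covers C.
  move=> n z; rewrite /C; case: (unpickle n) => [[i|[i|[i|i]]]|];
    by [exact: cPA|exact: cPB|exact: dense_ball_cover].
have Cu u k : (forall n, \forall m \near \oo, C n (k n) (u m)) ->
    exists a, [/\ conv2 u a, follows PA u & follows PB u].
  move=> uC; have lim (p : X * X -> X) : (forall i, exists j, forall l,
      C j l = ballC p i l) -> exists b, (fun m => f (p (u m)) : P) @ \oo --> (f b : P).
    move=> pC; have /cvg_ex[b ub] : cvg ((fun m => f (p (u m)) : P) @ \oo).
      apply: ball_cover_cvg => n; have [j jC] := pC n.
      by exists (k j); have := uC j; rewrite jC.
    by exists (g b); rewrite gK.
  have [b1 ub1] : exists b, (fun m => f (u m).1 : P) @ \oo --> (f b : P).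
    apply: (lim fst) => i.
    by exists (pickle (inr (inr (inl i)) : nat + (nat + (nat + nat)))) => l;
      rewrite /C pickleK.
  have [b2 ub2] : exists b, (fun m => f (u m).2 : P) @ \oo --> (f b : P).
    apply: (lim snd) => i.
    by exists (pickle (inr (inr (inr i)) : nat + (nat + (nat + nat)))) => l;
      rewrite /C pickleK.
  exists (b1, b2); split=> // i.
  - exists (k (pickle (inl i : nat + (nat + (nat + nat))))).
    by have := uC (pickle (inl i : nat + (nat + (nat + nat)))); rewrite /C pickleK.
  - exists (k (pickle (inr (inl i) : nat + (nat + (nat + nat))))).
    by have := uC (pickle (inr (inl i) : nat + (nat + (nat + nat))));
      rewrite /C pickleK.
apply: contrapT => /(not_separated_follows cC)[u [v [k [l [uv kl]]]]].
have [a [ua uA _]] : exists a, [/\ conv2 u a, follows PA u & follows PB u].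
  by apply: (Cu u k) => n; have [] := kl n.
have [b [vb _ vB]] : exists a, [/\ conv2 v a, follows PA v & follows PB v].
  by apply: (Cu v l) => n; have [] := kl n.
have Aa : A a.
  have [[]//|[_ nA]] := sA u a ua uA.
  by exfalso; near \oo => m; apply: (near nA m) => //; case: (uv m).
have Bb : B b.
  have [[]//|[_ nB]] := sB v b vb vB.
  by exfalso; near \oo => m; apply: (near nB m) => //; case: (uv m).
have : (f a.1 : P) != f b.1 by apply/eqP => /(can_inj fK); exact: AB.
move: hP; rewrite ball_hausdorff => /[apply] -[[r s]] /= /eqP rs.
(* Three radii [e i] lead from the limit to a late term, to the centre of the piece and to any of
   its points. The fourth leaves room for the interior of the ball around [f a.1], which separates
   two pieces that should be inseparable. *)
have t0 : 0 < Num.min r%:num s%:num / 4%:R by rewrite divr_gt0// lt_min !gt0.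
have [i _ /(_ i (leqnn _)) /= it] := near_infty_natSinv_lt (PosNum t0).
have [ir is_] : e i *+ 4 <= r%:num /\ e i *+ 4 <= s%:num.
  move: it; rewrite ltr_pdivlMr// mulr_natr lt_min => /andP[ir is_].
  by split; exact: ltW.
have close (w : nat -> X * X) c n : conv2 w c ->
    (\forall m \near \oo, ballC fst i n (w m)) ->
    forall z, ballC fst i n z -> ball (f c.1 : P) (e i *+ 3) (f z.1).
  move=> [wc _] wn z zn.
  have /wc wc' : nbhs (f c.1 : P) (ball (f c.1 : P) (e i)) by exact: nbhsx_ballx.
  near \oo => m; rewrite mulrSr mulr2n.
  apply: (ball_triangle _ zn); apply: (@ball_triangle _ _ (f (w m).1)).
    by near: m.
  by apply: ball_sym; near: m.
pose n := pickle (inr (inr (inl i)) : nat + (nat + (nat + nat))).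
have [] := kl n; rewrite /C /n pickleK -/n => nkl un vn.
apply: nkl; exists (f @^-1` ((ball (f a.1 : P) r%:num)° : set P)); split.
- exact: measurable_pre_ball.
- move=> _ [z /(close _ _ _ ua un) az <-].
  apply/nbhs_ballP; exists (e i) => [|y zy]; first exact: e_gt0.
  apply: (le_ball ir).
  by rewrite mulrSr; apply: ball_triangle zy.
- move=> _ [z /(close _ _ _ vb vn) bz <-] /= /interior_subset az.
  suff : set0 (f z.1 : P) by [].
  rewrite -rs; split=> //; apply: le_ball bz; apply: le_trans is_.
  by rewrite -(mulr_natr _ 3) -(mulr_natr _ 4) ler_wpM2l ?ler_nat// ltW.
Unshelve. all: by end_near. Qed.

(** The parts of the graph above [B] and above its complement have disjoint projections; as these
    cover [X], a set separating them is the preimage of [B]. *)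
Lemma measurable_fun_graph (h : X -> X) :
  measurable [set z : X * X | z.2 = h z.1] -> measurable_fun setT h.
Proof.
move=> mh _ B mB; rewrite setTI.
have [] := @separation ([set z | z.2 = h z.1] `&` snd @^-1` B)
   ([set z | z.2 = h z.1] `&` snd @^-1` (~` B)).
- by apply: measurableI => //; rewrite -[_ @^-1` _]setTI; exact: measurable_snd.
- apply: measurableI => //; rewrite -[_ @^-1` _]setTI; apply: measurable_snd => //.
  exact: measurableC.
- by move=> [x y] [x' y'] /= [-> hB] [-> nB] /= xx'; apply: nB; rewrite -xx'.
move=> C [mC hC nC]; suff -> : h @^-1` B = C by [].
apply/seteqP; split=> x.
  by move=> hx; apply: hC; exists (x, h x).
by move=> Cx; apply: contrapT => nB; apply: (nC x) => //; exists (x, h x).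
Qed.

Lemma separating_sets : exists V : nat -> set X, (forall i, measurable (V i)) /\
  forall x y, x <> y -> exists i, V i x /\ ~ V i y.
Proof.
pose V n := if unpickle n is Some (k, j) then
  f @^-1` ((ball (q k) (e j *+ 2))° : set P) else set0.
exists V; split=> [n|x y xy].
  by rewrite /V; case: (unpickle n) => [[k j]|] //; exact: measurable_pre_ball.
have : (f x : P) != f y by apply/eqP => /(can_inj fK).
move: hP; rewrite ball_hausdorff => /[apply] -[[r s]] /= /eqP rs.
(* One radius [e j] from [f x] to the centre [q k], and two from there to [f y]. *)
have t0 : 0 < r%:num / 3%:R by rewrite divr_gt0.
have [j _ /(_ j (leqnn _)) /= jt] := near_infty_natSinv_lt (PosNum t0).
have jr : e j *+ 3 <= r%:num.
  by move: jt; rewrite ltr_pdivlMr// mulr_natr => /ltW.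
have [k kx] := dense_ball_cover j (f x).
exists (pickle (k, j)); rewrite /V pickleK; split=> /=.
  apply/nbhs_ballP; exists (e j) => [|z xz]; first exact: e_gt0.
  by rewrite mulr2n; apply: ball_triangle xz.
move=> /interior_subset ky; suff : set0 (f y : P) by [].
rewrite -rs; split; last exact: ballxx.
apply: (le_ball jr); rewrite mulrS; apply: ball_triangle ky.
exact: ball_sym.
Qed.

End standard_borel.

Lemma dense_sequence (P : ptopologicalType) (D : set P) :
  countable D -> dense D -> exists q : nat -> P, dense (range q).
Proof.
move=> /pfcard_geP[->|[q]] dD.
  (* [P] is pointed, so the empty set is not dense. *)
  by have [|x []] := dD setT _ openT; first by exists point.
by exists q; rewrite image_eq.
Qed.

Section standard_borel_space.
Variables (R : realType) (d : measure_display) (X : measurableType d).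
Hypothesis hX : standard_borel R X.

Lemma standard_borel_measurable_fun (h : X -> X) :
  measurable [set z : X * X | z.2 = h z.1] -> measurable_fun setT h.
Proof.
have [P [[hP [D [/dense_sequence cD /cD[q dq]]]] [f [g [fK gK mf mg]]]]] := hX.
exact: measurable_fun_graph hP fK gK mf mg _ dq h.
Qed.

Lemma standard_borel_separating : exists V : nat -> set X,
  (forall i, measurable (V i)) /\ forall x y, x <> y -> exists i, V i x /\ ~ V i y.
Proof.
have [P [[hP [D [/dense_sequence cD /cD[q dq]]]] [f [g [fK gK mf mg]]]]] := hX.
exact: separating_sets hP fK mf _ dq.
Qed.

End standard_borel_space.

(* The least [n] with [Q n], and [0] if there is none. *)
Definition least (Q : nat -> Prop) : nat :=
  if pselect (exists n, `[<Q n>]) is left e then ex_minn e else 0%N.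

Lemma leastP (Q : nat -> Prop) : (exists n, Q n) -> Q (least Q).
Proof.
move=> [n Qn]; rewrite /least; case: pselect => [e|[]]; last first.
  by exists n; apply/asboolP.
by case: ex_minnP => m /asboolP.
Qed.

Lemma least_le (Q : nat -> Prop) n : Q n -> (least Q <= n)%N.
Proof.
move=> /asboolP Qn; rewrite /least; case: pselect => // e.
by case: ex_minnP => m _; apply.
Qed.

(** When [Q n] holds, this is the position of [n], counted from [0], in the increasing enumeration
    of [Q]. *)
Definition cnt (Q : nat -> Prop) n := count (fun m => `[<Q m>]) (iota 0 n).

Lemma cntS (Q : nat -> Prop) n : cnt Q n.+1 = (cnt Q n + `[<Q n>])%N.
Proof. by rewrite /cnt -addn1 iotaD count_cat /= addn0. Qed.

Lemma cnt_le (Q : nat -> Prop) m n : (m <= n)%N -> (cnt Q m <= cnt Q n)%N.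
Proof.
move=> /subnKC <-; elim: (n - m)%N => [|i IH]; first by rewrite addn0.
by rewrite addnS cntS (leq_trans IH)// leq_addr.
Qed.

Lemma cnt_lt (Q : nat -> Prop) m n : (m < n)%N -> Q m -> (cnt Q m < cnt Q n)%N.
Proof.
move=> mn Qm; apply: leq_trans (cnt_le Q mn).
by rewrite cntS (asboolT Qm) addn1.
Qed.

Lemma cnt_infinite (Q : nat -> Prop) :
  (forall m, exists2 k, (m <= k)%N & Q k) -> forall i, exists2 k, Q k & cnt Q k = i.
Proof.
move=> iQ; elim=> [|i [k Qk <-]].
  have [k _ Qk] := iQ 0%N; exists (least Q); first by apply: leastP; exists k.
  apply/eqP; rewrite -leqn0 leqNgt -has_count; apply/hasPn => m.
  rewrite mem_iota add0n => /andP[_ mQ]; apply/asboolPn => Qm.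
  by move: mQ; rewrite ltnNge least_le.
pose Q' n := (k < n)%N /\ Q n.
have /leastP [kn Qn] : exists n, Q' n by have [n kn Qn] := iQ k.+1; exists n.
exists (least Q') => //; rewrite /cnt -(subnKC kn) iotaD count_cat add0n.
rewrite -/(cnt Q k.+1) cntS (asboolT Qk) addn1 -[RHS]addn0; congr (_ + _)%N.
apply/eqP; rewrite -leqn0 leqNgt -has_count; apply/hasPn => m.
rewrite mem_iota => /andP[km]; rewrite subnKC// => mQ; apply/asboolPn => Qm.
by move: mQ; rewrite ltnNge least_le.
Qed.

(** * Closure properties of Borel predicates and of Borel functions to [nat] *)

Section measurable_predicates.
Variables (d : measure_display) (T : measurableType d).

Definition Mpred (P : T -> Prop) := measurable [set t | P t].

Definition Mnat (h : T -> nat) := forall n, Mpred (fun t => h t = n).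

Lemma Mpred_ext (P Q : T -> Prop) : (forall t, P t <-> Q t) -> Mpred Q -> Mpred P.
Proof.
by move=> PQ; rewrite /Mpred; congr measurable; apply/seteqP; split=> t /PQ.
Qed.

Lemma Mpred_cst (P : Prop) : Mpred (fun _ => P).
Proof.
have [p|np] := pselect P.
  apply: (@Mpred_ext _ (fun=> True)) => //; exact: measurableT.
by apply: (@Mpred_ext _ (fun=> False)) => //; exact: measurable0.
Qed.

Lemma Mpred_not (P : T -> Prop) : Mpred P -> Mpred (fun t => ~ P t).
Proof. by move=> mP; exact: measurableC. Qed.

Lemma Mpred_and (P Q : T -> Prop) :
  Mpred P -> Mpred Q -> Mpred (fun t => P t /\ Q t).
Proof. by move=> mP mQ; exact: measurableI. Qed.

Lemma Mpred_or (P Q : T -> Prop) :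
  Mpred P -> Mpred Q -> Mpred (fun t => P t \/ Q t).
Proof. by move=> mP mQ; exact: measurableU. Qed.

Lemma Mpred_imply (P Q : T -> Prop) :
  Mpred P -> Mpred Q -> Mpred (fun t => P t -> Q t).
Proof.
move=> mP mQ; apply: (Mpred_ext _ (Mpred_or (Mpred_not mP) mQ)) => t; split=> [PQ|].
  by have [/PQ|] := pselect (P t); [right|left].
by case.
Qed.

Lemma Mpred_iff (P Q : T -> Prop) :
  Mpred P -> Mpred Q -> Mpred (fun t => P t <-> Q t).
Proof. by move=> mP mQ; apply: Mpred_and; exact: Mpred_imply. Qed.

Lemma Mpred_exists (P : nat -> T -> Prop) :
  (forall n, Mpred (P n)) -> Mpred (fun t => exists n, P n t).
Proof.
move=> mP; apply: (@Mpred_ext _ (\bigcup_n P n)) => [t|].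
  2: exact: bigcupT_measurable.
by split=> [[n Pn]|[n _ Pn]]; exists n.
Qed.

Lemma Mpred_forall (P : nat -> T -> Prop) :
  (forall n, Mpred (P n)) -> Mpred (fun t => forall n, P n t).
Proof.
move=> mP; apply: (@Mpred_ext _ (\bigcap_n P n)) => [t|].
  2: exact: bigcapT_measurable.
by split=> [Pn n _|Pn n]; exact: Pn.
Qed.

(** A countable case distinction on the value of [h]. It is what allows indices found by [least] and
    [cnt] in later predicates. *)
Lemma Mpred_nat (h : T -> nat) (P : nat -> T -> Prop) :
  Mnat h -> (forall n, Mpred (P n)) -> Mpred (fun t => P (h t) t).
Proof.
move=> mh mP; have mhP n := Mpred_and (mh n) (mP n).
apply: (Mpred_ext _ (Mpred_exists mhP)) => t.
by split=> [Pt|[n [<-]]] //; exists (h t).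
Qed.

Lemma Mpred_eqn (h k : T -> nat) :
  Mnat h -> Mnat k -> Mpred (fun t => h t = k t).
Proof.
move=> mh mk; apply: (Mpred_nat (P := fun n t => h t = n)) => // n.
Qed.

Lemma Mpred_leq (h k : T -> nat) :
  Mnat h -> Mnat k -> Mpred (fun t => (h t <= k t)%N).
Proof.
move=> mh mk; apply: (Mpred_nat (P := fun n t => (h t <= n)%N)) => // n.
by apply: (Mpred_nat (P := fun m t => (m <= n)%N)) => // m; exact: Mpred_cst.
Qed.

Lemma Mnat_cst n : Mnat (fun _ => n).
Proof. by move=> m; exact: Mpred_cst. Qed.

Lemma Mnat_comp (h : T -> nat) (k : nat -> T -> nat) :
  Mnat h -> (forall n, Mnat (k n)) -> Mnat (fun t => k (h t) t).
Proof.
move=> mh mk n; apply: (Mpred_nat (P := fun i t => k i t = n)) => // i.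
exact: mk.
Qed.

Lemma Mnat_least (Q : nat -> T -> Prop) : (forall n, Mpred (Q n)) ->
  Mnat (fun t => least (fun n => Q n t)).
Proof.
(* The second alternative is the default value [0] of [least]. *)
move=> mQ n; apply: (@Mpred_ext _ (fun t =>
    (Q n t /\ forall m, (m < n)%N -> ~ Q m t) \/
    ((forall m, ~ Q m t) /\ n = 0%N))) => [t|]; last first.
  apply: Mpred_or; apply: Mpred_and => //; last exact: Mpred_cst.
    apply: Mpred_forall => m; apply: Mpred_imply; first exact: Mpred_cst.
    exact: Mpred_not.
  by apply: Mpred_forall => m; exact: Mpred_not.
split=> [<-|[[Qn nQ]|[nQ ->]]].
- have [eQ|nQ] := pselect (exists n, Q n t).
    left; split; first exact: (leastP (Q := fun n => Q n t)).
    move=> m mQn Qm; have := least_le (Q := fun n => Q n t) Qm.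
    by rewrite leqNgt mQn.
  right; split; first by move=> m Qm; apply: nQ; exists m.
  rewrite /least; case: pselect => // e; exfalso; apply: nQ.
  by case: e => m /asboolP; exists m.
- apply/eqP; rewrite eqn_leq (least_le (Q := fun n => Q n t) Qn) leqNgt.
  apply/negP => lt; apply: (nQ _ lt).
  by apply: (leastP (Q := fun n => Q n t)); exists n.
- rewrite /least; case: pselect => // e; exfalso.
  by case: e => m /asboolP /nQ.
Qed.

Lemma Mnat_cnt (Q : nat -> T -> Prop) (h : T -> nat) :
  (forall n, Mpred (Q n)) -> Mnat h -> Mnat (fun t => cnt (fun n => Q n t) (h t)).
Proof.
move=> mQ mh; apply: (Mnat_comp (k := fun n t => cnt (fun n => Q n t) n)) => //.
elim=> [|n IH]; first exact: Mnat_cst.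
move=> m; apply: (@Mpred_ext _ (fun t => (Q n t /\ (cnt (fun n => Q n t) n).+1 = m) \/
   (~ Q n t /\ cnt (fun n => Q n t) n = m))) => [t|].
  rewrite cntS; have [q|nq] := pselect (Q n t).
    by rewrite (asboolT q) addn1; split=> [|[[]|[]]]//; left.
  by rewrite (asboolF nq) addn0; split=> [|[[]|[]]]//; right.
apply: Mpred_or; apply: Mpred_and => //; last exact: Mpred_not.
by apply: (Mpred_nat (P := fun i t => i.+1 = m)) => // i; exact: Mpred_cst.
Qed.

End measurable_predicates.

Lemma Mpred_rel d d' (T : measurableType d) (X : measurableType d')
    (A : X -> X -> Prop) (f g : T -> X) : measurable [set z | A z.1 z.2] ->
  measurable_fun setT f -> measurable_fun setT g -> Mpred (fun t => A (f t) (g t)).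
Proof.
move=> mA mf mg.
by have := measurable_fun_pair mf mg measurableT mA; rewrite setTI.
Qed.

(** * The construction of the extension inside an orbit relation *)

Section core_definitions.
Variable X : Type.
Variables (W : nat -> X -> X) (V : nat -> set X) (g : nat -> X -> X).
Variables (E F L : X -> X -> Prop).

Definition orb x y := exists k, W k x = y.

Local Notation R := orb.

Definition key n x : bitseq := mkseq (fun i => `[<V i x>]) n.

Definition code_of n : nat * seq (bitseq * nat) := odflt (0%N, [::]) (unpickle n).

(* A code attaches a finite list of words to finitely many finite patterns of
   membership in the separating sets [V]; every finite subset of an orbit is
   coded at all of its points by one code. *)
Definition coded n x y :=
  exists k, (key (code_of n).1 x, k) \in (code_of n).2 /\ y = W k x.

(* [coded n x] is an [L]-invariant transversal of the [E]-classes in the orbit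
   of [x], and [n] codes the same set at all points of that set: so two of the
   sets coded by [n] are equal or disjoint. *)
Definition block n x :=
  coded n x x /\
  (forall y, R x y -> exists z, R x z /\ (coded n x z /\ E y z)) /\
  (forall z, R x z -> coded n x z ->
    forall w, R x w -> (coded n z w <-> coded n x w) /\
      (coded n x w -> E z w -> z = w) /\ (L z w -> coded n x w)).

(** Greedy choice, one code per stage: the block of [m] through [x] is added when none of its points
    was covered before. *)
Fixpoint cov n x := if n is m.+1 then
  cov m x \/ (block m x /\ forall z, R x z -> coded m x z -> ~ cov m z) else False.

Definition sel n x := block n x /\ forall z, R x z -> coded n x z -> ~ cov n z.

Definition match_ x y := exists n, sel n x /\ coded n x y.

Definition left_ x := forall n, ~ cov n x.

Definition defect x := exists y, R x y /\ left_ y.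

(** The guard [R x y] makes the quantifier over points one over words, hence over [nat], as
    measurability requires. *)
Definition leftE x := exists y, R x y /\ (E x y /\ left_ y).

(** In a defective orbit [g (n1 x) x] lies in an [E]-class that still has uncovered points, and
    [g (n2 x) x] in an exhausted one. *)
Definition n1 x := least (fun n => leftE (g n x)).
Definition n2 x := least (fun n => ~ leftE (g n x)).

(** From [g (n2 x) x], which is covered, the chosen transversal leads to the [E]-class of
    [g (n1 x) x], and the inverse of [g (n1 x)] leads back to the class of [x]. *)
Definition push_rel x z := E x z /\ match_ (g (n2 x) x) (g (n1 x) z).

Definition push x := W (least (fun k => push_rel x (W k x))) x.

Definition chain_root x := defect x /\ left_ (g (n1 x) x).

(* Labels distinguish the points of an [L]-class; they replace a Borel linear
   order. *)
Definition depth z := least (fun n =>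
  forall w, R z w -> L z w -> key n z = key n w -> z = w).

Definition label z := pickle (key (depth z) z).

Definition rank z :=
  cnt (fun m => exists w, R z w /\ (L z w /\ label w = m)) (label z).

Definition lead z := W (least (fun k => L z (W k z) /\
  forall w, R z w -> L z w -> (label (W k z) <= label w)%N)) z.

Definition good_root y c r := F y r /\ (chain_root r /\
  forall m, exists k, (m <= k)%N /\ rank (iter k push r) = c).

(** Taking the least colour that works for some root makes the choice depend only on the [F]-class
    inside the orbit. *)
Definition color y := least (fun c => exists r, R y r /\ good_root y c r).

(* The [i]-th point of colour [color y] in the chain of [r] encodes [W i r]. *)
Definition encodes y x z := exists r, R y r /\ (good_root y (color y) r /\
  exists k, z = iter k push r /\ (rank z = color y /\
    W (cnt (fun j => rank (iter j push r) = color y) k) r = x)).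

Definition enc y x := lead (W (least (fun j => encodes y x (W j x))) x).

(* Schroeder-Bernstein for [enc y] and the inclusion in the orbit of the set of
   leading points of the [L]-classes in the [F]-class of [y]. *)
Definition orphan y x := exists n, exists w,
  R y w /\ (~ (F y w /\ lead w = w) /\ iter n (enc y) w = x).

Definition sbmap y x q :=
  (orphan y x /\ q = enc y x) \/ (~ orphan y x /\ q = x).

Definition extension x z := R x z /\ ((~ defect x /\ match_ x z) \/
  (defect x /\ exists v, R x v /\ (sbmap x v (lead x) /\ sbmap z v (lead z)))).

End core_definitions.

(** * Measurability of the construction *)

Section core_measurability.
Variables (d : measure_display) (X : measurableType d).
Variables (W : nat -> X -> X) (V : nat -> set X) (g : nat -> X -> X).
Variables (E F L : X -> X -> Prop).
Hypotheses (mW : forall k, measurable_fun setT (W k))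
  (mg : forall k, measurable_fun setT (g k)) (mV : forall i, measurable (V i))
  (sepV : forall x y, x <> y -> exists i, V i x /\ ~ V i y)
  (mE : measurable [set z | E z.1 z.2]) (mF : measurable [set z | F z.1 z.2])
  (mL : measurable [set z | L z.1 z.2]).

Local Notation R := (orb W).
Local Notation Mfun := (measurable_fun [set: _]).

Section over.
Variables (d' : measure_display) (T : measurableType d').
Implicit Types (a b c : T -> X) (h : T -> nat).

Lemma Mpred_E a b : Mfun a -> Mfun b -> Mpred (fun t => E (a t) (b t)).
Proof. exact: Mpred_rel. Qed.

Lemma Mpred_F a b : Mfun a -> Mfun b -> Mpred (fun t => F (a t) (b t)).
Proof. exact: Mpred_rel. Qed.

Lemma Mpred_L a b : Mfun a -> Mfun b -> Mpred (fun t => L (a t) (b t)).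
Proof. exact: Mpred_rel. Qed.

Lemma Mpred_V i a : Mfun a -> Mpred (fun t => V i (a t)).
Proof. by move=> ma; have := ma measurableT _ (mV i); rewrite setTI. Qed.

Lemma Mpred_eq a b : Mfun a -> Mfun b -> Mpred (fun t => a t = b t).
Proof.
move=> ma mb; apply: (@Mpred_ext _ _ _ (fun t => forall i, V i (a t) -> V i (b t))).
  move=> t; split=> [-> //|ab]; apply: contrapT => /sepV[i [Va]]; apply.
  exact: ab.
by apply: Mpred_forall => i; apply: Mpred_imply; apply: Mpred_V.
Qed.

Lemma Mfun_sel (s : nat -> X -> X) h a : (forall k, Mfun (s k)) -> Mnat h ->
  Mfun a -> Mfun (fun t => s (h t) (a t)).
Proof.
move=> ms mh ma _ B mB; rewrite setTI.
apply: (@Mpred_nat _ _ h (fun n t => B (s n (a t)))) => // n.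
by have := measurableT_comp (ms n) ma measurableT mB; rewrite setTI.
Qed.

Lemma Mfun_W h a : Mnat h -> Mfun a -> Mfun (fun t => W (h t) (a t)).
Proof. exact: Mfun_sel. Qed.

Lemma Mfun_g h a : Mnat h -> Mfun a -> Mfun (fun t => g (h t) (a t)).
Proof. exact: Mfun_sel. Qed.

Lemma Mpred_orb a b : Mfun a -> Mfun b -> Mpred (fun t => R (a t) (b t)).
Proof.
move=> ma mb; apply: Mpred_exists => k; apply: Mpred_eq => //.
by apply: Mfun_W => //; exact: Mnat_cst.
Qed.

Lemma Mpred_exists_orb a (P : T -> X -> Prop) : Mfun a ->
  (forall k, Mpred (fun t => P t (W k (a t)))) ->
  Mpred (fun t => exists y, R (a t) y /\ P t y).
Proof.
move=> ma mP; apply: (Mpred_ext _ (Mpred_exists mP)) => t.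
split=> [[_ [[k <-] Pk]]|[k Pk]]; first by exists k.
by exists (W k (a t)); split=> //; exists k.
Qed.

Lemma Mpred_forall_orb a (P : T -> X -> Prop) : Mfun a ->
  (forall k, Mpred (fun t => P t (W k (a t)))) ->
  Mpred (fun t => forall y, R (a t) y -> P t y).
Proof.
move=> ma mP; apply: (Mpred_ext _ (Mpred_forall mP)) => t.
by split=> [Pt k|Pt _ [k <-]]; apply: Pt; exists k.
Qed.

(** The set [B] is arbitrary so that the induction can split off the last bit. *)
Lemma Mpred_key n a (B : set bitseq) : Mfun a -> Mpred (fun t => B (key V n (a t))).
Proof.
move=> ma; elim: n B => [|n IH] B; first exact: (@Mpred_cst _ T (B [::])).
apply: (@Mpred_ext _ _ _ (fun t =>
    (V n (a t) /\ [set s | B (rcons s true)] (key V n (a t))) \/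
    (~ V n (a t) /\ [set s | B (rcons s false)] (key V n (a t))))) => [t|].
  rewrite {1}/key mkseqS /=; have [v|nv] := pselect (V n (a t)).
    by rewrite (asboolT v); split=> [|[[]|[]]] //; left.
  by rewrite (asboolF nv); split=> [|[[]|[]]] //; right.
apply: Mpred_or; apply: Mpred_and; try exact: IH; first exact: Mpred_V.
exact/Mpred_not/Mpred_V.
Qed.

Lemma Mnat_key (n : nat) a : Mfun a -> Mnat (fun t => pickle (key V n (a t))).
Proof. by move=> ma m; apply: (@Mpred_key n a [set s | pickle s = m]). Qed.

End over.

(** The search follows the logical form of a definition. [simple apply] limits unfolding, and
    [meas_defs] is rebound as lemmas on further definitions become available. *)
Ltac meas_step := first
  [ assumption
  | simple apply Mpred_E | simple apply Mpred_F | simple apply Mpred_L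
  | simple apply Mpred_orb
  | simple apply Mpred_exists_orb | simple apply Mpred_forall_orb
  | simple apply Mpred_and | simple apply Mpred_or
  | simple apply Mpred_iff | simple apply Mpred_not
  | simple apply Mpred_imply
  | simple apply Mpred_exists | simple apply Mpred_forall
  | simple apply Mpred_eq | simple apply Mpred_eqn | simple apply Mpred_leq
  | simple apply Mpred_cst
  | simple apply Mfun_W | simple apply Mfun_g
  | simple apply Mnat_least | simple apply Mnat_cnt | simple apply Mnat_cst ].

Ltac meas_defs := fail.

Ltac meas := repeat first [progress intros | meas_defs | meas_step].

Section definitions_over.
Variables (d' : measure_display) (T : measurableType d').
Implicit Types (a b c : T -> X) (h : T -> nat).

Lemma Mpred_coded n a b : Mfun a -> Mfun b -> Mpred (fun t => coded W V n (a t) (b t)).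
Proof.
move=> ma mb; apply: Mpred_exists => k; apply: Mpred_and; last by meas.
exact: (@Mpred_key _ _ _ _ [set s | (s, k) \in (code_of n).2]).
Qed.

Ltac meas_defs ::= simple apply Mpred_coded.

Lemma Mpred_block n a : Mfun a -> Mpred (fun t => block W V E L n (a t)).
Proof. by rewrite /block; meas. Qed.

Ltac meas_defs ::= first [simple apply Mpred_coded | simple apply Mpred_block].

Lemma Mpred_cov n a : Mfun a -> Mpred (fun t => cov W V E L n (a t)).
(* The function [a] stays general because [cov] is also evaluated at other points of the orbit. *)
Proof. by elim: n a => [|n IH] a ma /=; meas; apply: IH; meas. Qed.

Ltac meas_defs ::= first [simple apply Mpred_coded | simple apply Mpred_block
  | simple apply Mpred_cov].

Local Notation M := (match_ W V E L).

Lemma Mpred_match a b : Mfun a -> Mfun b -> Mpred (fun t => M (a t) (b t)).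
Proof. by rewrite /match_ /sel; meas. Qed.

Lemma Mpred_left a : Mfun a -> Mpred (fun t => left_ W V E L (a t)).
Proof. by rewrite /left_; meas. Qed.

Ltac meas_defs ::= first [simple apply Mpred_match | simple apply Mpred_left].

Lemma Mpred_defect a : Mfun a -> Mpred (fun t => defect W V E L (a t)).
Proof. by rewrite /defect; meas. Qed.

Lemma Mpred_leftE a : Mfun a -> Mpred (fun t => leftE W V E L (a t)).
Proof. by rewrite /leftE; meas. Qed.

Ltac meas_defs ::= first [simple apply Mpred_match | simple apply Mpred_left
  | simple apply Mpred_defect | simple apply Mpred_leftE].

Lemma Mnat_n1 a : Mfun a -> Mnat (fun t => n1 W V g E L (a t)).
Proof. by rewrite /n1; meas. Qed.

Lemma Mnat_n2 a : Mfun a -> Mnat (fun t => n2 W V g E L (a t)).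
Proof. by rewrite /n2; meas. Qed.

Ltac meas_defs ::= first [simple apply Mpred_match | simple apply Mpred_left
  | simple apply Mpred_defect | simple apply Mnat_n1 | simple apply Mnat_n2].

Lemma Mfun_push a : Mfun a -> Mfun (fun t => push W V g E L (a t)).
Proof. by rewrite /push /push_rel; meas. Qed.

Lemma Mfun_iter_push n a : Mfun a -> Mfun (fun t => iter n (push W V g E L) (a t)).
Proof. by move=> ma; elim: n => //= n IH; exact: Mfun_push. Qed.

Lemma Mpred_chain_root a : Mfun a -> Mpred (fun t => chain_root W V g E L (a t)).
Proof. by rewrite /chain_root; meas. Qed.

Lemma Mpred_eq_key n a b : Mfun a -> Mfun b ->
  Mpred (fun t => key V n (a t) = key V n (b t)).
Proof.
move=> ma mb.
apply: (Mpred_ext _ (Mpred_eqn (Mnat_key n ma) (Mnat_key n mb))) => t.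
by split=> [->//|]; exact: (pcan_inj pickleK).
Qed.

Ltac meas_defs ::= first [simple apply Mpred_eq_key].

Lemma Mnat_depth a : Mfun a -> Mnat (fun t => depth W V L (a t)).
Proof. by rewrite /depth; meas. Qed.

Lemma Mnat_label a : Mfun a -> Mnat (fun t => label W V L (a t)).
Proof.
move=> ma; rewrite /label.
apply: (@Mnat_comp _ _ _ (fun n t => pickle (key V n (a t)))) => [|n].
  exact: Mnat_depth.
exact: Mnat_key.
Qed.

Ltac meas_defs ::= simple apply Mnat_label.

Lemma Mnat_rank a : Mfun a -> Mnat (fun t => rank W V L (a t)).
Proof. by rewrite /rank; meas. Qed.

Lemma Mfun_lead a : Mfun a -> Mfun (fun t => lead W V L (a t)).
Proof. by rewrite /lead; meas. Qed.

Ltac meas_defs ::= first [simple apply Mpred_chain_root | simple apply Mfun_iter_push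
  | simple apply Mnat_rank | simple apply Mfun_lead].

Lemma Mpred_good_root a b h : Mfun a -> Mnat h -> Mfun b ->
  Mpred (fun t => good_root W V g E F L (a t) (h t) (b t)).
Proof. by rewrite /good_root; meas. Qed.

Ltac meas_defs ::= first [simple apply Mpred_chain_root | simple apply Mfun_iter_push
  | simple apply Mnat_rank | simple apply Mfun_lead | simple apply Mpred_good_root].

Lemma Mnat_color a : Mfun a -> Mnat (fun t => color W V g E F L (a t)).
Proof. by rewrite /color; meas. Qed.

Ltac meas_defs ::= first [simple apply Mfun_iter_push
  | simple apply Mnat_rank | simple apply Mfun_lead | simple apply Mpred_good_root
  | simple apply Mnat_color].

Lemma Mpred_encodes a b c : Mfun a -> Mfun b -> Mfun c ->
  Mpred (fun t => encodes W V g E F L (a t) (b t) (c t)).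
Proof. by rewrite /encodes; meas. Qed.

Ltac meas_defs ::= first [simple apply Mfun_lead | simple apply Mpred_encodes].

Lemma Mfun_enc a b : Mfun a -> Mfun b -> Mfun (fun t => enc W V g E F L (a t) (b t)).
Proof. by rewrite /enc; meas. Qed.

Lemma Mfun_iter_enc n a b : Mfun a -> Mfun b ->
  Mfun (fun t => iter n (enc W V g E F L (a t)) (b t)).
Proof. by move=> ma mb; elim: n => //= n IH; exact: Mfun_enc. Qed.

Ltac meas_defs ::= first [simple apply Mfun_lead | simple apply Mfun_iter_enc].

Lemma Mpred_orphan a b : Mfun a -> Mfun b ->
  Mpred (fun t => orphan W V g E F L (a t) (b t)).
Proof. by rewrite /orphan; meas. Qed.

Ltac meas_defs ::= first [simple apply Mfun_enc | simple apply Mpred_orphan].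

Lemma Mpred_sbmap a b c : Mfun a -> Mfun b -> Mfun c ->
  Mpred (fun t => sbmap W V g E F L (a t) (b t) (c t)).
Proof. by rewrite /sbmap; meas. Qed.

Ltac meas_defs ::= first [simple apply Mfun_lead | simple apply Mpred_sbmap
  | simple apply Mpred_defect | simple apply Mpred_match].

Lemma Mpred_extension a b : Mfun a -> Mfun b ->
  Mpred (fun t => extension W V g E F L (a t) (b t)).
Proof. by rewrite /extension; meas. Qed.

End definitions_over.

Lemma measurable_extension :
  measurable [set z : X * X | extension W V g E F L z.1 z.2].
Proof.
exact: (Mpred_extension (a := fst) (b := snd) measurable_fst measurable_snd).
Qed.

End core_measurability.

Lemma pigeonhole (h : nat -> nat) N : (forall k, (h k < N)%N) ->
  exists c, forall m, exists k, (m <= k)%N /\ h k = c.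
Proof.
move=> hN; apply: contrapT => nc.
have /choice[b hb] : forall c, exists m, forall k, (m <= k)%N -> h k <> c.
  move=> c; apply: contrapT => nm; apply: nc; exists c => m.
  apply: contrapT => nk; apply: nm; exists m => k mk hk.
  by apply: nk; exists k.
(* Beyond [K] none of the values below [N] would occur any more. *)
pose K := \max_(c < N) b c.
apply: (hb (h K) K) => //.
exact: (leq_bigmax_cond (Ordinal (hN K))).
Qed.

(** * Correctness of the construction *)

Section core_correctness.
Variables (d : measure_display) (X : measurableType d).
Variables (W : nat -> X -> X) (V : nat -> set X) (g : nat -> X -> X).
Variables (E F L : X -> X -> Prop).
Local Notation R := (orb W).
Hypotheses (sepV : forall x y, x <> y -> exists i, V i x /\ ~ V i y)
  (Rr : forall x, R x x) (Rs : forall x y, R x y -> R y x)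
  (Rt : forall x y z, R x y -> R y z -> R x z)
  (Er : forall x, E x x) (Es : forall x y, E x y -> E y x)
  (Et : forall x y z, E x y -> E y z -> E x z)
  (Fs : forall x y, F x y -> F y x)
  (Ft : forall x y z, F x y -> F y z -> F x z)
  (Lr : forall x, L x x) (Ls : forall x y, L x y -> L y x)
  (Lt : forall x y z, L x y -> L y z -> L x z)
  (EF : forall x y, E x y -> F x y)
  (LF : forall x y, L x y -> F x y) (LR : forall x y, L x y -> R x y)
  (Lex : forall x y, F x y -> exists z, L x z /\ E y z)
  (Lun : forall x y, L x y -> E x y -> x = y)
  (gE : forall n x y, E x y <-> E (g n x) (g n y))
  (g_inj : forall n, injective (g n)) (g_surj : forall n y, exists x, g n x = y)
  (gR : forall n x, R x (g n x))
  (gtr : forall x y, R x y -> exists n, E (g n x) y)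
  (fin : forall x, exists s : seq X, forall y, R x y -> exists2 e, e \in s & E e y).

Local Notation coded := (coded W V).
Local Notation key := (key V).
Local Notation M := (match_ W V E L).
Local Notation left_ := (left_ W V E L).
Local Notation sel := (sel W V E L).
Local Notation cov := (cov W V E L).
Local Notation block := (block W V E L).
Local Notation defect := (defect W V E L).
Local Notation leftE := (leftE W V E L).
Local Notation n1 := (n1 W V g E L).
Local Notation n2 := (n2 W V g E L).
Local Notation push := (push W V g E L).
Local Notation chain_root := (chain_root W V g E L).
Local Notation depth := (depth W V L).
Local Notation label := (label W V L).
Local Notation rank := (rank W V L).
Local Notation lead := (lead W V L).
Local Notation good_root := (good_root W V g E F L).
Local Notation color := (color W V g E F L).
Local Notation encodes := (encodes W V g E F L).
Local Notation enc := (enc W V g E F L).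
Local Notation orphan := (orphan W V g E F L).
Local Notation sbmap := (sbmap W V g E F L).
Local Notation extension := (extension W V g E F L).

(** * Codes of finite subsets of an orbit *)

Lemma key_nth n i x : (i < n)%N -> nth false (key n x) i = `[<V i x>].
Proof. by move=> lt_in; rewrite nth_mkseq. Qed.

Lemma key_separates (s : seq X) :
  exists n, {in s &, forall x y, key n x = key n y -> x = y}.
Proof.
have /choice[i iP] : forall z : X * X, exists i, z.1 <> z.2 -> V i z.1 /\ ~ V i z.2.
  move=> z; have [e|/sepV[i Vi]] := pselect (z.1 = z.2); first by exists 0%N.
  by exists i.
exists (\max_(x <- s) \max_(y <- s) (i (x, y)).+1) => x y xs ys xy.
apply: contrapT => /[dup] nxy /(iP (x, y)) /= [Vx nVy]; apply: nVy.
have lt : (i (x, y) < \max_(x <- s) \max_(y <- s) (i (x, y)).+1)%N.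
  apply: leq_trans (leq_bigmax_seq _ xs isT).
  exact: (@leq_bigmax_seq _ s xpredT (fun y => (i (x, y)).+1) y ys isT).
move: (congr1 (fun t => nth false t (i (x, y))) xy).
by rewrite !key_nth// (asboolT Vx) => /esym/asboolP.
Qed.

Lemma transversal_finite x (S : set X) : (forall y, S y -> R x y) ->
  (forall y z, S y -> S z -> E y z -> y = z) ->
  exists s : seq X, forall y, S y <-> y \in s.
Proof.
move=> SR SE; have [s0 s0P] := fin x.
(* One point of [S] is picked in the class of each representative. A class missed by [S] contributes
   the default [x]; the filter removes what is not in [S]. *)
exists [seq y <- [seq xget x (S `&` [set y | E e y]) | e <- s0] | `[<S y>]] => y.
rewrite mem_filter; split=> [Sy|/andP[/asboolP]//].
rewrite (asboolT Sy) /=; have [e es ey] := s0P y (SR y Sy).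
apply/mapP; exists e => //.
have [Sz ez] : (S `&` [set y | E e y]) (xget x (S `&` [set y | E e y])).
  by apply: xgetI; split; [exact: Sy|].
by apply: SE => //; apply: Et ez; exact: Es.
Qed.

(** The code lists, for all [z] and [w] in [s], a word leading from [z] to [w], attached to the key
    of [z]. Keys of length [m] are distinct on [s], so at a point of [s] only the words attached to
    that point apply. *)
Lemma code_exists (s : seq X) : {in s &, forall x y, R x y} ->
  exists n, {in s, forall x y, coded n x y <-> y \in s}.
Proof.
move=> sR; have [m mP] := key_separates s.
have /choice[k kP] : forall z : X * X, exists k, R z.1 z.2 -> W k z.1 = z.2.
  move=> z; have [[k]|n] := pselect (R z.1 z.2); first by exists k.
  by exists 0%N.
pose c : nat * seq (bitseq * nat) := (m, [seq (key m z, k (z, w)) | z <- s, w <- s]).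
have dc : code_of (pickle c) = c by rewrite /code_of pickleK.
exists (pickle c) => x xs y; rewrite /coded dc /=; split.
  move=> [i [/allpairsP[[z w]] /= [zs ws [/mP xz ->]] ->]].
  by rewrite -(xz xs zs) kP//; exact: sR.
move=> ys; exists (k (x, y)); split; last by rewrite kP//; exact: sR.
by apply/allpairsP; exists (x, y).
Qed.

(** * The chosen transversals and the uncovered points *)

Lemma codedR n x y : coded n x y -> R x y.
Proof. by move=> [k [_ ->]]; exists k. Qed.

(** [block] asserts this for [w] in the orbit; elsewhere both sides fail. *)
Lemma coded_block n x z : block n x -> coded n x z ->
  forall w, coded n z w <-> coded n x w.
Proof.
move=> [_ [_ bx]] xz w; have xzR := codedR xz.
have [xw|nxw] := pselect (R x w); first by have [] := bx z xzR xz w xw.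
split=> [zw|xw]; exfalso; apply: nxw; last exact: codedR xw.
exact: Rt (codedR zw).
Qed.

Lemma sel_coded n x z : sel n x -> coded n x z -> sel n z.
Proof.
move=> [bx nx] xz; have xzR := codedR xz; have zw := coded_block bx xz.
split; last first.
  by move=> w zwR /zw xw; apply: nx => //; exact: codedR xw.
have [xx [bE bx']] := bx; split; first exact/zw.
split=> [y zy|w zwR /zw xw v zvR].
  have [w [xw [cw yw]]] := bE y (Rt xzR zy).
  by exists w; split; [apply: Rt xw; exact: Rs|split=> //; exact/zw].
have xvR : R x v := Rt xzR zvR.
have [wv [wE wL]] := bx' w (Rt xzR zwR) xw v xvR.
by split; [rewrite wv zw|split=> [/zw//|/wL/zw]].
Qed.

Lemma cov_le m n x : (m <= n)%N -> cov m x -> cov n x.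
Proof.
move=> /subnKC <-; elim: (n - m)%N => [|i IH]; first by rewrite addn0.
by rewrite addnS => /IH; left.
Qed.

Lemma sel_cov n x : sel n x -> cov n.+1 x.
Proof. by move=> [bx nx]; right. Qed.

Lemma cov_sel n x : cov n x -> exists m, sel m x.
Proof. by elim: n => //= n IH [/IH//|bx]; exists n. Qed.

(** A point selected at the earlier stage is covered at the later one, which rules out a second
    selection. *)
Lemma sel_inj n m x : sel n x -> sel m x -> n = m.
Proof.
wlog lt : n m / (n < m)%N => [h|] sn sm.
  by have [lt|lt|//] := ltngtP n m; [exact: h|exact/esym/h].
have [[xx _] /(_ x (Rr x) xx)] := sm.
by case; apply: cov_le (sel_cov sn).
Qed.

Lemma matchR x y : M x y -> R x y.
Proof. by move=> [n [_ /codedR]]. Qed.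

Lemma match_refl x : ~ left_ x -> M x x.
Proof.
move=> nx; have [n sx] : exists n, sel n x.
  apply: contrapT => ns; apply: nx => n /cov_sel[m sm]; apply: ns; by exists m.
by exists n; split=> //; case: sx => -[].
Qed.

Lemma match_sym x y : M x y -> M y x.
Proof.
move=> [n [sx xy]]; exists n; split; first exact: sel_coded sx xy.
by have [bx _] := sx; apply/(coded_block bx xy); case: bx.
Qed.

Lemma match_left x y : M x y -> ~ left_ x.
Proof. by move=> [n [/sel_cov cx _]] /(_ n.+1). Qed.

Lemma match_trans x y z : M x y -> M y z -> M x z.
Proof.
move=> [n [sx xy]] [m [sy yz]]; exists n; split=> //.
have nm := sel_inj (sel_coded sx xy) sy; move: yz; rewrite -nm.
by have [bx _] := sx; move/(coded_block bx xy).
Qed.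

Lemma match_ex x y : ~ left_ x -> R x y -> exists z, M x z /\ E y z.
Proof.
move=> /match_refl[n [sx _]] xy; have [[_ [bE _]] _] := sx.
by have [z [_ [xz yz]]] := bE y xy; exists z; split=> //; exists n.
Qed.

Lemma match_un x y : M x y -> E x y -> x = y.
Proof.
move=> [n [[[xx [_ bx]] _] xy]] exy.
have [_ [+ _]] := bx x (Rr x) xx y (codedR xy); exact.
Qed.

Lemma match_L x y : ~ left_ x -> L x y -> M x y.
Proof.
move=> /match_refl[n [sx xx]] xy; exists n; split=> //.
have [[_ [_ bx]] _] := sx.
have [_ [_]] := bx x (Rr x) xx y (LR xy); exact.
Qed.

Lemma left_L x y : left_ x -> L x y -> left_ y.
Proof.
move=> lx xy; apply: contrapT => ny; apply: (match_left (y := y)) lx.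
by apply: match_sym; apply: match_L => //; exact: Ls.
Qed.

(* Otherwise the uncovered set would contain an [L]-invariant transversal, which
   some code would have selected. *)
Lemma left_incomplete x :
  exists y, R x y /\ forall z, R x z -> E y z -> ~ left_ z.
Proof.
apply: contrapT => nx.
have full y : R x y -> exists z, R x z /\ E y z /\ left_ z.
  move=> xy; apply: contrapT => nz; apply: nx; exists y; split=> // z xz yz lz.
  by apply: nz; exists z.
(* One uncovered point for each [F]-class in the orbit: by [qF] the choice depends on the class
   alone, as [xget] is applied to equal sets. The [L]-classes of these points make up the
   transversal [S]. *)
pose q y := xget x [set z | R x z /\ F y z /\ left_ z].
have qP y : R x y -> [/\ R x (q y), F y (q y) & left_ (q y)].
  move=> /full[z [xz [yz lz]]].
  suff [? []] : [set z | R x z /\ F y z /\ left_ z] (q y) by [].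
  by apply: (@xgetI _ x _ z); split=> //; split=> //; exact: EF.
have qF y z : F y z -> q y = q z.
  move=> yz; rewrite /q; congr xget; apply/seteqP; split=> w [xw [yw lw]].
    by split=> //; split=> //; apply: Ft yw; exact: Fs.
  by split=> //; split=> //; apply: Ft yw.
pose S y := R x y /\ L (q y) y.
have qS y : R x y -> exists2 z, S z & E y z.
  move=> xy; have [xq yq lq] := qP y xy.
  have [z [qz yz]] := Lex (Fs yq); exists z => //; split; last first.
    by rewrite -(qF y) //; exact: EF.
  exact: Rt (LR qz).
have SE y z : S y -> S z -> E y z -> y = z.
  move=> [xy qy] [xz qz] yz; apply: Lun => //; apply: Lt qz.
  by rewrite -(qF y); [exact: Ls|exact: EF].
have Sl y : S y -> left_ y.
  by move=> [xy qy]; have [_ _ lq] := qP y xy; exact: left_L qy.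
have SL y z : S y -> L y z -> S z.
  move=> [xy qy] yz; split; first exact: Rt (LR yz).
  by rewrite -(qF y); [exact: Lt yz|exact: LF].
have [s sP] := @transversal_finite x S (fun y Sy => proj1 Sy) SE.
have [n nP] : exists n, {in s, forall x y, coded n x y <-> y \in s}.
  apply: code_exists => y z /sP[xy _] /sP[xz _].
  by apply: Rt xz; exact: Rs.
have [y Sy _] := qS x (Rr x).
have xy := proj1 Sy.
have cS u v : S u -> coded n u v <-> S v by move=> /sP us; rewrite nP// sP.
(* No point of [S] is covered, so stage [n] takes [S] and thereby covers [y], against [Sl]. *)
apply: (Sl y Sy n.+1); right; split; last first.
  by move=> z _ /(cS _ _ Sy) Sz; exact: Sl.
split; first exact/cS.
split=> [z yz|z yz /(cS _ _ Sy) Sz w yw].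
  have [w Sw zw] := qS z (Rt xy yz); exists w; split; last by rewrite cS.
  by apply: Rt (proj1 Sw); exact: Rs.
split; first by rewrite !cS.
split=> [/(cS _ _ Sy) Sw|zw]; first exact: SE.
by apply/cS => //; exact: SL zw.
Qed.

(** * The injection of each [E]-class into itself and its chains *)

Lemma leftE_E x y : R x y -> E x y -> leftE x -> leftE y.
Proof.
move=> xy exy [z [xz [exz lz]]]; exists z; split; first by apply: Rt xz; exact: Rs.
by split=> //; apply: Et exz; exact: Es.
Qed.

Lemma gRR n x y : R x y -> R (g n x) (g n y).
Proof. by move=> xy; apply: Rt (gR n y); apply: Rt xy; exact: Rs. Qed.

Lemma leftE_g_E n x y : R x y -> E x y -> leftE (g n x) = leftE (g n y).
Proof.
move=> xy exy; apply/propext; split; apply: leftE_E; try exact: gRR.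
- exact: (gE _ _ _).1.
- by apply: gRR; exact: Rs.
- by apply: (gE _ _ _).1; exact: Es.
Qed.

(** Group elements preserve [E], so the search gives the same result throughout an [E]-class of the
    orbit. *)
Lemma n1_E x y : R x y -> E x y -> n1 x = n1 y.
Proof. by move=> xy exy; congr least; apply/funext => n; exact: leftE_g_E. Qed.

Lemma n2_E x y : R x y -> E x y -> n2 x = n2 y.
Proof.
by move=> xy exy; congr least; apply/funext => n; rewrite (leftE_g_E n xy exy).
Qed.

Lemma defect_R x y : R x y -> defect x -> defect y.
Proof. by move=> xy [z [xz lz]]; exists z; split=> //; apply: Rt xz; exact: Rs. Qed.

Lemma n1P x : defect x -> leftE (g (n1 x) x).
Proof.
move=> [y [xy ly]]; apply: (leastP (Q := fun n => leftE (g n x))).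
have [n ny] := gtr xy; exists n, y; split=> //.
by apply: Rt xy; exact/Rs/gR.
Qed.

Lemma n2P x : ~ leftE (g (n2 x) x).
Proof.
apply: (leastP (Q := fun n => ~ leftE (g n x))).
have [y [xy ny]] := left_incomplete x; have [n gy] := gtr xy; exists n.
move=> [z [gz [egz lz]]]; apply: (ny z _ _ lz); first exact: Rt (gR n x) gz.
by apply: Et egz; exact: Es.
Qed.

Lemma pushP x : defect x ->
  [/\ R x (push x), E x (push x) & M (g (n2 x) x) (g (n1 x) (push x))].
Proof.
move=> dx; suff [k Wk] : exists k, push_rel W V g E L x (W k x).
  have [ex mx] := leastP (ex_intro (fun k => push_rel W V g E L x (W k x)) k Wk).
  by split=> //; eexists; reflexivity.
(* The [E]-class of [g (n2 x) x] is exhausted, so this point lies on a chosen transversal. *)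
have n2x : ~ left_ (g (n2 x) x).
  by move=> l; apply: (@n2P x); exists (g (n2 x) x); split; [exact: Rr|].
have n12 : R (g (n2 x) x) (g (n1 x) x).
  by apply: Rt (gR _ x); exact/Rs/gR.
have [w [mw ew]] := match_ex n2x n12.
have [z zw] := g_surj (n1 x) w; rewrite -zw in mw ew.
have [k kz] : R x z.
  by apply: Rt (Rs (gR (n1 x) z)); exact: Rt (gR (n2 x) x) (matchR mw).
by exists k; rewrite kz; split=> //; exact: (gE (n1 x) _ _).2.
Qed.

(** Equal values force [E]-equivalence, hence equal [n1] and [n2]. Then [g (n2 x)] sends [x] and [y]
    to [E]-equivalent points of one chosen transversal, which coincide. *)
Lemma push_inj x y : defect x -> defect y -> push x = push y -> x = y.
Proof.
move=> dx dy xy; have [rx ex mx] := pushP dx; have [ry ey my] := pushP dy.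
rewrite -xy in ry ey my; have rxy : R x y := Rt rx (Rs ry).
have exy : E x y := Et ex (Es ey).
move: my; rewrite -(n1_E rxy exy) -(n2_E rxy exy) => my.
apply: (g_inj (n := n2 x)); apply: match_un; last exact: (gE _ _ _).1.
exact: match_trans mx (match_sym my).
Qed.

(** [g (n1 x)] sends [push x] to a covered point, and [n1] agrees at [x] and [push x]. *)
Lemma root_push x : defect x -> ~ chain_root (push x).
Proof.
move=> dx [_]; have [rx ex mx] := pushP dx.
by rewrite -(n1_E rx ex); apply: match_left (match_sym mx).
Qed.

(** An uncovered point of the [E]-class of [g (n1 x) x], pulled back by [g (n1 x)], is a root. *)
Lemma root_ex x : defect x -> exists r, [/\ R x r, E x r & chain_root r].
Proof.
move=> dx; have [y [gy [ey ly]]] := n1P dx.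
have [r ry] := g_surj (n1 x) y; exists r; rewrite -ry in gy ey ly.
have xr : R x r by apply: Rt (Rs (gR (n1 x) r)); exact: Rt (gR (n1 x) x) gy.
have exr : E x r by exact: (gE (n1 x) _ _).2.
by split=> //; split; [exact: defect_R dx|rewrite -(n1_E xr exr)].
Qed.

Lemma iter_push k x : defect x -> R x (iter k push x) /\ E x (iter k push x).
Proof.
move=> dx; elim: k => [|k [xk exk]] //=.
have [? ? _] := pushP (defect_R xk dx).
by split; [exact: Rt xk _|exact: Et exk _].
Qed.

Lemma iter_push_defect k x : defect x -> defect (iter k push x).
Proof. by move=> dx; have [xk _] := iter_push k dx; exact: defect_R dx. Qed.

(** Injectivity strips [push] from both sides until a root remains, and a root is no value of
    [push]. So chains of distinct roots are disjoint and no chain repeats. *)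
Lemma iter_push_inj k l r s : chain_root r -> chain_root s ->
  iter k push r = iter l push s -> k = l /\ r = s.
Proof.
move=> rr rs; have [[dr _] [ds _]] := (rr, rs).
elim: k l => [|k IH] [|l] //= => [rl|rk|/push_inj kl].
- by exfalso; apply: (root_push (iter_push_defect l ds)); rewrite -rl.
- by exfalso; apply: (root_push (iter_push_defect k dr)); rewrite rk.
- by have [->] := IH l (kl (iter_push_defect k dr) (iter_push_defect l ds)).
Qed.

(** * Labels, ranks and leading points of [L]-classes *)

Lemma depthP z w : L z w -> key (depth z) z = key (depth z) w -> z = w.
Proof.
move=> zw; suff /leastP/(_ w (LR zw) zw) : exists n,
  forall w, R z w -> L z w -> key n z = key n w -> z = w by [].
(* The [L]-class is finite: it meets each of the finitely many [E]-classes of the orbit at most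
   once. *)
have [s sP] := @transversal_finite z (L z) (@LR z)
  (fun u v zu zv uv => Lun (Lt (Ls zu) zv) uv).
have [n nP] := key_separates s.
by exists n => u _ zu; apply: nP; apply/sP.
Qed.

Lemma label_inj x y : L x y -> label x = label y -> x = y.
Proof.
move=> xy /(pcan_inj pickleK) kxy; apply: depthP => //; rewrite kxy.
(* The length of a key is the depth at which it was taken, so equal labels have equal depths. *)
by move: (congr1 size kxy); rewrite !size_mkseq => ->.
Qed.

Let mates_ z m := exists w, R z w /\ (L z w /\ label w = m).

Lemma rank_lt x y : L x y -> (label x < label y)%N -> (rank x < rank y)%N.
Proof.
move=> xy lxy; change (cnt (mates_ x) (label x) < cnt (mates_ y) (label y))%N.
have -> : mates_ x = mates_ y.
  apply/funext => m; apply/propext; split=> -[w [xw [lw wm]]]; exists w.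
    by split; [apply: Rt xw; exact/LR/Ls|split=> //; apply: Lt lw; exact: Ls].
  by split; [exact: Rt (LR xy) xw|split=> //; exact: Lt xy lw].
apply: cnt_lt => //; exists x; split; first exact/Rs/LR.
by split=> //; exact: Ls.
Qed.

Lemma rank_inj x y : L x y -> rank x = rank y -> x = y.
Proof.
move=> xy rxy; apply: (label_inj xy).
have [lt|lt|//] := ltngtP (label x) (label y).
  by have := rank_lt xy lt; rewrite rxy ltnn.
by have := rank_lt (Ls xy) lt; rewrite rxy ltnn.
Qed.

(* An [L]-class has at most as many points as there are [E]-classes around. *)
Lemma rank_bounded x : exists N, forall y, R x y -> (rank y < N)%N.
Proof.
have [s sP] := fin x; exists (size s).+1 => y xy; rewrite ltnS.
have /choice[e eP] : forall m, exists e, mates_ y m ->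
    e \in s /\ forall w, L y w -> label w = m -> E e w.
  move=> m; have [[w [yw [lw wm]]]|n] := pselect (mates_ y m); last by exists x.
  have [e es ew] := sP w (Rt xy yw); exists e => _; split=> // w' lw' wm'.
  by rewrite -(label_inj (x := w) (y := w')) ?wm' //; apply: Lt lw'; exact: Ls.
rewrite /rank /cnt -size_filter; set t := seq.filter _ _.
have tP m : m \in t -> mates_ y m by rewrite mem_filter => /andP[/asboolP].
rewrite -(size_map e t); apply: uniq_leq_size.
  rewrite map_inj_in_uniq; first exact/seq.filter_uniq/iota_uniq.
  move=> m n /tP mm /tP mn emn.
  have [_ em] := eP m mm; have [_ en] := eP n mn.
  have [[w [_ [lw wm]]] [v [_ [lv vn]]]] := (mm, mn).
  rewrite -wm -vn (Lun (x := w) (y := v)) //; first by apply: Lt lv; exact: Ls.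
  by apply: Et (en v lv vn); rewrite -emn; apply/Es/em.
by move=> _ /mapP[m /tP mm ->]; have [] := eP m mm.
Qed.

Lemma lead_min x : L x (lead x) /\
  forall w, L x w -> (label (lead x) <= label w)%N.
Proof.
suff /leastP[? h] : exists k, L x (W k x) /\
    forall w, R x w -> L x w -> (label (W k x) <= label w)%N.
  by split=> // w xw; apply: h => //; exact: LR.
have [|w [xw lw]] := leastP (Q := fun m => exists w, L x w /\ label w = m).
  by exists (label x), x.
have [k kw] := LR xw; exists k; rewrite kw; split=> // v _ xv.
by rewrite lw; apply: least_le; exists v.
Qed.

Lemma L_lead x : L x (lead x).
Proof. by have [] := lead_min x. Qed.

Lemma lead_L x y : L x y -> lead x = lead y.
Proof.
move=> xy; have [lx hx] := lead_min x; have [ly hy] := lead_min y.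
apply: label_inj; first exact: Lt (Ls lx) (Lt xy ly).
apply/eqP; rewrite eqn_leq hx ?hy//; last exact: Lt xy ly.
exact: Lt (Ls xy) lx.
Qed.

Lemma L_of_lead x y : lead x = lead y -> L x y.
Proof. by move=> xy; apply: Lt (L_lead x) _; rewrite xy; apply: Ls; exact: L_lead. Qed.

Lemma F_lead x : F x (lead x). Proof. exact: LF (L_lead x). Qed.

Lemma lead_lead x : lead (lead x) = lead x.
Proof. by rewrite -(lead_L (L_lead x)). Qed.

(** * Encoding an orbit into the [L]-classes of an [F]-class *)

Lemma good_root_F y y' c r : F y y' -> good_root y c r -> good_root y' c r.
Proof. by move=> yy' [yr h]; split=> //; apply: Ft yr; exact: Fs. Qed.

(** Ranks are bounded on the orbit, so some rank recurs for ever along the chain of a root. *)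
Lemma color_root y : defect y -> exists r, R y r /\ good_root y (color y) r.
Proof.
move=> dy; apply: (leastP (Q := fun c => exists r, R y r /\ good_root y c r)).
have [r [yr eyr rr]] := root_ex dy; have [N hN] := rank_bounded r.
have dr : defect r by case: rr.
have [c hc] : exists c, forall m, exists k,
    (m <= k)%N /\ rank (iter k push r) = c.
  by apply: (@pigeonhole _ N) => k; apply: hN; have [] := iter_push k dr.
by exists c, r; split=> //; split; [exact: EF|].
Qed.

Lemma color_F y y' : F y y' -> R y y' -> color y = color y'.
Proof.
move=> Fy Ry; congr least; apply/funext => c; apply/propext.
split=> -[r [yr gr]]; exists r.
  by split; [apply: Rt yr; exact: Rs|exact: good_root_F gr].
by split; [exact: Rt yr|apply: good_root_F gr; exact: Fs].
Qed.

Lemma encodesP y x : R y x -> defect y -> exists z, R x z /\ encodes y x z.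
Proof.
move=> yx dy; have [r [yr gr]] := color_root dy.
have [_ [[dr _] inf]] := gr; have [i rx] : R r x := Rt (Rs yr) yx.
(* [x] is the value of word [i] at [r], and it is encoded by the [i]-th point of the right
   colour. *)
have [k rk ki] : exists2 k, rank (iter k push r) = color y &
    cnt (fun j => rank (iter j push r) = color y) k = i.
  apply: (cnt_infinite (Q := fun j => rank (iter j push r) = color y)) => m.
  by have [k [mk rk]] := inf m; exists k.
exists (iter k push r); split.
  by apply: Rt (Rs yx) _; apply: Rt yr _; have [] := iter_push k dr.
by exists r; split=> //; split=> //; exists k; split=> //; split=> //; rewrite ki.
Qed.

Lemma encodes_F y y' : F y y' -> R y y' -> encodes y = encodes y'.
Proof.
move=> Fy Ry; apply/funext => x; apply/funext => z; apply/propext.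
rewrite /encodes (color_F Fy Ry); split=> -[r [yr [gr h]]]; exists r.
  by split; [apply: Rt yr; exact: Rs|split=> //; exact: good_root_F gr].
split; first exact: Rt yr.
by split=> //; apply: good_root_F gr; exact: Fs.
Qed.

Lemma encodes_spec y x z : encodes y x z -> [/\ R y z, F y z & rank z = color y].
Proof.
move=> [r [yr [[Fyr [[dr _] _]] [k [-> [rk _]]]]]].
have [rz ez] := iter_push k dr; split=> //; first exact: Rt rz.
by apply: Ft Fyr _; exact: EF.
Qed.

(** [z] determines its root and its place in the chain, hence the word and its value. *)
Lemma encodes_inj y x x' z : encodes y x z -> encodes y x' z -> x = x'.
Proof.
move=> [r [_ [[_ [rr _]] [k [-> [_ <-]]]]]] [s [_ [[_ [rs _]] [l [+ [_ <-]]]]]].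
by move=> /(iter_push_inj rr rs)[-> ->].
Qed.

Lemma enc_spec y x : R y x -> defect y ->
  exists z, encodes y x z /\ enc y x = lead z.
Proof.
move=> yx dy; have [z [[k <-] xz]] := encodesP yx dy.
have := leastP (ex_intro (fun k => encodes y x (W k x)) k xz).
by eexists; split; [eassumption|].
Qed.

Lemma encP y x : R y x -> defect y ->
  [/\ R y (enc y x), F y (enc y x) & lead (enc y x) = enc y x].
Proof.
move=> yx dy; have [z [yxz ->]] := enc_spec yx dy.
have [yz Fyz _] := encodes_spec yxz; split; last exact: lead_lead.
  by apply: Rt yz _; exact/LR/L_lead.
by apply: Ft Fyz _; exact: F_lead.
Qed.

(** Passing to leading points loses nothing: encoding points of one [L]-class all have rank
    [color y], so they coincide. *)
Lemma enc_inj y x x' : defect y -> R y x -> R y x' -> enc y x = enc y x' -> x = x'.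
Proof.
move=> dy yx yx'; have [z [xz ->]] := enc_spec yx dy.
have [z' [xz' ->]] := enc_spec yx' dy => /L_of_lead zz'.
have [_ _ rz] := encodes_spec xz; have [_ _ rz'] := encodes_spec xz'.
have e : z = z' by apply: rank_inj => //; rewrite rz rz'.
by rewrite -e in xz'; exact: encodes_inj xz xz'.
Qed.

Lemma enc_F y y' : F y y' -> R y y' -> enc y = enc y'.
Proof. by move=> Fy Ry; rewrite /enc (encodes_F Fy Ry). Qed.

(** * The Schroeder-Bernstein bijection *)

Lemma orphan_F y y' : F y y' -> R y y' -> orphan y = orphan y'.
Proof.
move=> Fy Ry; apply/funext => x; apply/propext; rewrite /orphan (enc_F Fy Ry).
split=> -[n [w [yw [nw h]]]]; exists n, w; split.
- by apply: Rt yw; exact: Rs.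
- by split=> // -[Fw lw]; apply: nw; split=> //; exact: Ft Fw.
- exact: Rt yw.
- by split=> // -[Fw lw]; apply: nw; split=> //; apply: Ft Fw; exact: Fs.
Qed.

Lemma sbmap_F y y' : F y y' -> R y y' -> sbmap y = sbmap y'.
Proof.
by move=> Fy Ry; rewrite /sbmap (orphan_F Fy Ry) (enc_F Fy Ry).
Qed.

Lemma orphan_enc y x : orphan y x -> orphan y (enc y x).
Proof. by move=> [n [w [yw [nw <-]]]]; exists n.+1, w. Qed.

Lemma not_orphan y x : R y x -> ~ orphan y x -> F y x /\ lead x = x.
Proof. by move=> yx no; apply: contrapT => nx; apply: no; exists 0%N, x. Qed.

Lemma sbmap_total y x : defect y -> R y x ->
  exists q, sbmap y x q /\ [/\ R y q, F y q & lead q = q].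
Proof.
move=> dy yx; have [yx_|no] := pselect (orphan y x).
  by exists (enc y x); split; [left|exact: encP].
by exists x; split; [right|have [] := not_orphan yx no].
Qed.

Lemma sbmap_fun y x q q' : sbmap y x q -> sbmap y x q' -> q = q'.
Proof. by move=> [[p ->]|[no ->]] [[p' ->]|[no' ->]]. Qed.

Lemma sbmap_inj y x x' q : defect y -> R y x -> R y x' ->
  sbmap y x q -> sbmap y x' q -> x = x'.
Proof.
move=> dy yx yx' [[p ->]|[no ->]] [[p' e]|[no' e]] //.
- exact: enc_inj e.
(* [enc y] maps orphans to orphans, so the two branches of [sbmap] have disjoint images. *)
- by exfalso; apply: no'; rewrite -e; exact: orphan_enc.
- by exfalso; apply: no; rewrite e; exact: orphan_enc.
Qed.

(** A leading point that is an orphan arises after at least one step of [enc y], since stage [0]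
    lies outside the leading points; its predecessor is mapped to it. Other leading points are
    fixed. *)
Lemma sbmap_onto y q : defect y -> R y q -> F y q -> lead q = q ->
  exists x, R y x /\ sbmap y x q.
Proof.
move=> dy yq Fq lq; have [[m]|no] := pselect (orphan y q).
case: m => [|n] [w [yw [nw /= wq]]].
- by exfalso; apply: nw; rewrite wq.
- exists (iter n (enc y) w); split; last by left; split=> //; exists n, w.
  by elim: n {wq} => //= n IH; have [] := encP IH dy.
- by exists q; split=> //; right.
Qed.

(** * The extension is a transversal equivalence relation *)

Lemma L_extension x y : L x y -> extension x y.
Proof.
move=> xy; split; first exact: LR.
have [dx|ndx] := pselect (defect x); [right|left]; split=> //.
  have [v [xv bv]] := sbmap_onto dx (LR (L_lead x)) (F_lead x) (lead_lead x).
  exists v; split=> //; split=> //.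
  by rewrite -(sbmap_F (LF xy) (LR xy)) -(lead_L xy).
by apply: match_L => // lx; apply: ndx; exists x.
Qed.

Lemma extension_sym x y : extension x y -> extension y x.
Proof.
move=> [xy h]; split; first exact: Rs.
case: h => [[ndx mxy]|[dx [v [xv [bx by_]]]]]; [left|right]; split.
- by move=> dy; apply: ndx; apply: defect_R dy; exact: Rs.
- exact: match_sym.
- exact: defect_R dx.
- by exists v; split=> //; apply: Rt xv; exact: Rs.
Qed.

Lemma extension_trans x y z : extension x y -> extension y z -> extension x z.
Proof.
move=> [xy h] [yz k]; split; first exact: Rt yz.
case: h => [[ndx mxy]|[dx [v [xv [bx by_]]]]]; [left|right]; split=> //.
  case: k => [[_ myz]|[dy _]]; first exact: match_trans myz.
  by exfalso; apply: ndx; apply: defect_R dy; exact: Rs.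
case: k => [[ndy _]|[dy [w [yw [by' bz]]]]].
  by exfalso; apply: ndy; exact: defect_R dx.
exists v; split=> //; split=> //; suff -> : v = w by [].
by apply: sbmap_inj by_ by' => //; apply: Rt xv; exact: Rs.
Qed.

Lemma extension_ex x y : R x y -> exists z, extension x z /\ E y z.
Proof.
move=> xy; have [dx|ndx] := pselect (defect x); last first.
  have nlx : ~ left_ x by move=> lx; apply: ndx; exists x.
  have [z [xz yz]] := match_ex nlx xy.
  by exists z; split=> //; split; [exact: matchR|left].
have dy := defect_R xy dx.
have [v [xv bv]] := sbmap_onto dx (LR (L_lead x)) (F_lead x) (lead_lead x).
(* [q] leads the [L]-class that has, in the [F]-class of [y], the same index [v] as the class of
   [x]; it meets the [E]-class of [y]. *)
have [q [bq [yq Fq lq]]] := sbmap_total dy (Rt (Rs xy) xv).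
have [z [qz yz]] := Lex (Fs Fq); exists z; split=> //.
have xz : R x z := Rt xy (Rt yq (LR qz)).
split=> //; right; split=> //; exists v; split=> //; split=> //.
rewrite -(lead_L qz) lq -(sbmap_F (EF yz)) //; exact: Rt yq (LR qz).
Qed.

(** In a defective orbit, [E]-equivalent points share their [F]-class and so the map [sbmap]; a
    common index then gives a common leading point, hence [L]-equivalence. *)
Lemma extension_un x y : extension x y -> E x y -> x = y.
Proof.
move=> [xy [[_ mxy]|[dx [v [_ [bx by_]]]]]] exy; first exact: match_un.
apply: Lun => //; apply: L_of_lead; apply: sbmap_fun bx _.
by rewrite (sbmap_F (EF exy) xy).
Qed.

Lemma extension_transversal :
  [/\ forall x y, L x y -> extension x y,
      forall x y, extension x y -> extension y x,
      forall x y z, extension x y -> extension y z -> extension x z &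
      forall x y, R x y -> exists! z, extension x z /\ E y z].
Proof.
split; [exact: L_extension|exact: extension_sym|exact: extension_trans|].
move=> x y /extension_ex[z [xz yz]]; exists z; split=> // w [xw yw].
apply: extension_un; last by apply: Et yw; exact: Es.
by apply: extension_trans xw; exact: extension_sym.
Qed.

End core_correctness.

(** * Words in countably many functions *)

Section words.
Variables (X : Type) (I : countType) (s : I -> X -> X).

Definition word n x := foldr s x (odflt [::] (unpickle n)).

Lemma orb_word (w : seq I) x : orb word x (foldr s x w).
Proof. by exists (pickle w); rewrite /word pickleK. Qed.

Lemma orb_word_refl x : orb word x x.
Proof. exact: (orb_word [::]). Qed.

Lemma orb_word_step i x : orb word x (s i x).
Proof. exact: (orb_word [:: i]). Qed.

Lemma orb_word_trans x y z : orb word x y -> orb word y z -> orb word x z.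
Proof. by move=> [k <-] [l <-]; rewrite /word -foldr_cat; exact: orb_word. Qed.

Lemma orb_word_ind (Q : X -> Prop) x :
  Q x -> (forall i y, Q y -> Q (s i y)) -> forall y, orb word x y -> Q y.
Proof.
move=> Qx Qs _ [k <-]; rewrite /word.
by elim: (odflt _ _) => //= i w IH; exact: Qs.
Qed.

(** Inverses are required only pointwise: different generators may undo [s i] at different
    points. *)
Lemma orb_word_sym : (forall i x, exists j, s j (s i x) = x) ->
  forall x y, orb word x y -> orb word y x.
Proof.
move=> inv x; apply: orb_word_ind => [|i y yx]; first exact: orb_word_refl.
apply: orb_word_trans yx; have [j jy] := inv i y.
by rewrite -{2}jy; exact: orb_word_step.
Qed.

End words.

Lemma measurable_word d (X : measurableType d) (I : countType) (s : I -> X -> X) n :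
  (forall i, measurable_fun setT (s i)) -> measurable_fun setT (word s n).
Proof.
move=> ms; rewrite /word; elim: (odflt _ _) => [|i w IH] /=.
  exact: measurable_id.
exact: (measurableT_comp (ms i) IH).
Qed.

(** * Links and finite index in pointwise form *)

Section links.
Variables (d : measure_display) (X : measurableType d).
Implicit Types E F L : set (X * X).

Lemma cber_measurable_rel E : cber E -> measurable [set z : X * X | E (z.1, z.2)].
Proof.
by case=> mE _ _ _ _; move: mE; congr measurable; apply/seteqP; split=> -[].
Qed.

(** Since [E] and [L] lie in [F], restricting them to an [F]-class leaves the classes of its points
    unchanged. *)
Lemma linkP E F L : cber E -> cber F -> cber L -> L `<=` F -> E `<=` F ->
  link E F L <-> forall x y, F (x, y) -> exists! z, L (x, z) /\ E (y, z).
Proof.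
move=> cE cF cL LF EF; split=> [[_ _ lk] x y xy|lk].
  have /lk/(_ (eclass (restr E (eclass F x)) y) (eclass (restr L (eclass F x)) x)) :
    classes [set: X] F (eclass F x) by exists x.
  case; [by exists y|by exists x; [exact: cber_refl|]|].
  move=> z [[[/= yz _] [/= xz _]] zu]; exists z; split=> // w [xw yw].
  by apply: zu; split; split=> //; split=> //=; [exact: LF|exact: cber_refl|exact: LF].
split=> // _ [c _ <-] _ _ [a ca <-] [b cb <-].
have ba : F (b, a) by apply: (cber_trans cF) ca; exact: cber_sym.
have [z [[bz az] zu]] := lk b a ba.
exists z; split=> [|w [[aw _] [bw _]]]; last exact: zu.
have cz : F (c, z) by apply: (cber_trans cF cb); exact: LF.
by split; split.
Qed.

Lemma finite_index_seq E F : cber E -> cber F -> E `<=` F -> finite_index E F ->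
  forall x, exists s : seq X, forall y, F (x, y) -> exists2 e, e \in s & E (e, y).
Proof.
move=> cE cF EF fi x; have /fi/finite_seqP[s sE] : classes [set: X] F (eclass F x).
  by exists x.
exists [seq xget point A | A <- s] => y xy.
have Ey : eclass E y \in s.
  have : [set` s] (eclass E y).
    rewrite -sE; split; first by exists y.
    by move=> z yz; apply: (cber_trans cF xy); exact: EF.
  by [].
exists (xget point (eclass E y)); first exact: map_f.
apply: (cber_sym cE); apply: (@xgetI _ point (eclass E y) y).
exact: cber_refl.
Qed.

End links.

Theorem theorem5p8 (R : realType) (d : measure_display) (X : measurableType d)
    (hX : standard_borel R X) (E F F' : set (X * X))
    (cE : cber E) (cF : cber F) (cF' : cber F')
    (sEF : E `<=` F) (sFF' : F `<=` F')
    (hfin : finite_index E F') (hnorm : normal_in E F') :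
  forall L : set (X * X), link E F L ->
    exists L' : set (X * X), link E F' L' /\ L `<=` L'.
Proof.
move=> L lkL; have [cL LF _] := lkL.
have Lex := (linkP cE cF cL LF sEF).1 lkL.
have [V [mV sepV]] := standard_borel_separating hX.
have [G [/pfcard_geP cG [GA G1 Gc Gi] F'E]] := hnorm.
have [g gG] : exists g : nat -> X -> X, range g = G.
  case: cG => [G0|[g]]; first by move: G1; rewrite G0.
  by exists g; rewrite image_eq.
have gin n : G (g n) by rewrite -gG; exists n.
have gex h : G h -> exists n, g n = h by rewrite -gG => -[n _ <-]; exists n.
have gA n := GA _ (gin n).
have mg n : measurable_fun setT (g n) by case: (gA n).
have gF' n x : F' (x, g n x).
  by rewrite F'E; exists (g n) => //=; exact: cber_refl.
have F'g x y : F' (x, y) -> exists n, E (g n x, y).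
  by rewrite F'E => -[h /gex[n <-]] /= xy; exists n.
(* The second alternative is a default that makes these functions total. *)
have /choice[lam' lam'P] (p : nat * X) : exists z,
    (F (p.2, g p.1 p.2) /\ L (p.2, z) /\ E (g p.1 p.2, z)) \/
    (~ F (p.2, g p.1 p.2) /\ z = p.2).
  case: p => n x /=; have [Fx|nFx] := pselect (F (x, g n x)); last by exists x; right.
  by have [z [[xz gz] _]] := Lex _ _ Fx; exists z; left.
pose lam n x := lam' (n, x).
have lamP n x : (F (x, g n x) /\ L (x, lam n x) /\ E (g n x, lam n x)) \/
    (~ F (x, g n x) /\ lam n x = x) by exact: (lam'P (n, x)).
have lamE n x z : F (x, g n x) -> L (x, z) -> E (g n x, z) -> lam n x = z.
  move=> Fx xz gz; have [w [_ wu]] := Lex _ _ Fx.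
  have [[_ /wu <-]|[//]] := lamP n x.
  by apply: wu.
have mlam n : measurable_fun setT (lam n).
  apply: (standard_borel_measurable_fun hX).
  (* The graph is described without quantifiers, so that it is Borel. *)
  apply: (@Mpred_ext _ _ (fun z => z.2 = lam n z.1)
    (fun z => (F (z.1, g n z.1) /\ (L (z.1, z.2) /\ E (g n z.1, z.2))) \/
      (~ F (z.1, g n z.1) /\ z.2 = z.1))) => [[x y] /=|].
    split=> [->|]; first exact: lamP.
    case=> [[Fx [xy gy]]|[nF ->]]; first by rewrite (lamE n x y).
    by have [[]|[]] := lamP n x.
  have mg1 : measurable_fun setT (fun z : X * X => g n z.1).
    exact: measurableT_comp (mg n) measurable_fst.
  have mF : Mpred (fun z : X * X => F (z.1, g n z.1)).
    apply: (@Mpred_rel _ _ _ _ (fun x y => F (x, y)) fst) => //.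
    exact: cber_measurable_rel.
  have mL : Mpred (fun z : X * X => L (z.1, z.2)).
    exact: cber_measurable_rel.
  have mE : Mpred (fun z : X * X => E (g n z.1, z.2)).
    apply: (@Mpred_rel _ _ _ _ (fun x y => E (x, y)) _ snd) => //.
    exact: cber_measurable_rel.
  apply: Mpred_or; apply: Mpred_and => //; first exact: Mpred_and.
    exact: Mpred_not.
  exact: (Mpred_eq mV sepV measurable_snd measurable_fst).
pose st (i : nat + nat) := match i with inl n => g n | inr n => lam n end.
pose W := word st.
have mst i : measurable_fun setT (st i) by case: i.
have mW n : measurable_fun setT (W n) by exact: measurable_word.
pose Q := orb W.
have Qr x : Q x x by exact: orb_word_refl.
have Qt x y z : Q x y -> Q y z -> Q x z by exact: orb_word_trans.
have Qg n x : Q x (g n x) by exact: (orb_word_step st (inl n)).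
have Ls x y : L (x, y) -> L (y, x) by exact: (cber_sym cL).
have Fs x y : F (x, y) -> F (y, x) by exact: (cber_sym cF).
have Es x y : E (x, y) -> E (y, x) by exact: (cber_sym cE).
have inv i x : exists j, st j (st i x) = x.
  case: i => n /=.
    by have [h /gex[m <-] [gK _]] := Gi _ (gin n); exists (inl m); exact: gK.
  have [[Fx [xl _]]|[nF ->]] := lamP n x; last first.
    by exists (inr n); rewrite /=; have [[]|[]] := lamP n x.
  (* The move to [lam n x] is undone by [lam m], where [g m] takes [lam n x] into the [E]-class of
     [x]. *)
  have [m gm] := F'g _ _ (sFF' _ (LF _ (Ls _ _ xl))).
  exists (inr m) => /=; apply: lamE => //; last exact: Ls.
  by apply: (cber_trans cF (LF _ (Ls _ _ xl))); apply/sEF/Es.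
have Qs x y : Q x y -> Q y x by exact: orb_word_sym.
have LQ x y : L (x, y) -> Q x y.
  move=> xy; have [n gn] := F'g _ _ (sFF' _ (LF _ xy)).
  rewrite -(lamE n x y) //; first exact: (orb_word_step st (inr n)).
  by apply: (cber_trans cF (LF _ xy)); apply/sEF/Es.
have QF' x y : Q x y -> F' (x, y).
  apply: (orb_word_ind (Q := fun y => F' (x, y))) => [|i z xz].
    exact: (cber_refl cF').
  apply: (cber_trans cF' xz); case: i => n //=.
  have [[_ [zl _]]|[_ ->]] := lamP n z; last exact: (cber_refl cF').
  exact/sFF'/LF.
have sEF' : E `<=` F' by move=> z /sEF/sFF'.
have Lex' x y : F (x, y) -> exists z, L (x, z) /\ E (y, z).
  by move=> /Lex[z [? _]]; exists z.
have Lun x y : L (x, y) -> E (x, y) -> x = y.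
  move=> xy exy; have [z [_ zu]] := Lex x x (cber_refl cF x).
  rewrite -(zu x) ?(zu y) //; split; [exact: cber_refl cL x|exact: cber_refl cE x].
have gE n x y : E (x, y) <-> E (g n x, g n y) by case: (gA n).
have g_inj n : injective (g n) by case: (gA n) => /bij_inj.
have g_surj n y : exists x, g n x = y.
  by have [[h _ hK] _ _] := gA n; exists (h y).
have QgE x y : Q x y -> exists n, E (g n x, y) by move=> /QF'/F'g.
have fin x : exists s : seq X, forall y, Q x y -> exists2 e, e \in s & E (e, y).
  have [s sP] := finite_index_seq cE cF' sEF' hfin x.
  by exists s => y /QF'/sP.
pose rel (A : set (X * X)) x y := A (x, y).
pose ext := extension W V g (rel E) (rel F) (rel L).
have [L_ext ext_sym ext_trans ext_ex] :
  [/\ forall x y, rel L x y -> ext x y,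
      forall x y, ext x y -> ext y x,
      forall x y z, ext x y -> ext y z -> ext x z &
      forall x y, Q x y -> exists! z, ext x z /\ rel E y z].
  apply: extension_transversal => //.
  - exact: (cber_refl cE).
  - exact: (cber_trans cE).
  - exact: (cber_trans cF).
  - exact: (cber_refl cL).
  - exact: (cber_trans cL).
  - by move=> x y; exact: sEF.
  - by move=> x y; exact: LF.
pose L' := [set z : X * X | ext z.1 z.2].
have L'F' : L' `<=` F' by move=> [x y] /= [/QF'].
have cL' : cber L'.
  split=> //.
  - apply: measurable_extension => //; exact: cber_measurable_rel.
  - by move=> x; apply: L_ext; exact: cber_refl.
  - move=> x; apply: (@sub_countable _ _ _ (eclass F' x)).
      by apply: subset_card_le => y; exact: L'F'.
    exact: cber_countable.
exists L'; split; last by move=> [x y]; exact: L_ext.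
apply/(linkP cE cF' cL' L'F' sEF') => x y /F'g[n gny].
(* The orbit of [x] need not contain [y], but it contains [g n x] from the [E]-class of [y], and the
   condition on [z] depends only on that class. *)
have [z [[xz gz] zu]] := ext_ex _ _ (Qg n x).
exists z; split=> [|w [xw yw]].
  by split=> //; apply: (cber_trans cE _ gz); exact: Es.
by apply: zu; split=> //; exact: (cber_trans cE gny).
Qed.
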